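(* Let $n>4$ be an integer and let $TF_n$ be the quadratic form $\sum_{i,j=1}^n a_{ij}x_ix_j$ whose symmetric matrix $(a_{ij})$ is defined as follows. If $n$ is even: $$a_{ii}=1\ (1\le i\le n-1),\qquad a_{nn}=\tfrac12 n^2-\tfrac72 n+7,$$ $$a_{ij}=\frac{n-4}{2(n-2)}\ (i\ne j,\ i,j<n),\qquad a_{in}=a_{ni}=-\frac{n^2-6n+10}{2(n-2)}\ (i<n).$$ If $n$ is odd: $$a_{ii}=1\ (1\le i\le n-1),\qquad a_{nn}=\frac{n^3-8n^2+23n-20}{2(n-1)},$$ $$a_{ij}=\frac{n-3}{2(n-1)}\ (i\ne j,\ i,j<n),\qquad a_{in}=a_{ni}=-\frac{n^2-5n+8}{2(n-1)}\ (i<n).$$ Then $TF_n$ is a perfect form, and the cone $TW(n)$ is a common wall of a perfect domain of type $D_n$ and of the perfect domain of $TF_n$. Moreover, $TF_5$ is equivalent to $\phi_2^5$ (the third perfect form of Korkine and Zolotareff in $5$ variables), and $TF_6$ is equivalent to $E_6^{*}$.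
   Context: Let $N=n(n+1)/2$ and let $Sym(n,\mathbb{R})\cong\mathbb{R}^N$ be the space of real quadratic forms in $n$ variables. Perfect forms. The arithmetic minimum of a positive definite form $f$ is $m=\min\{f(v): v\in\mathbb{Z}^n\setminus\{0\}\}$, and the vectors $v\in\mathbb{Z}^n$ with $f(v)=m$ are its minimal vectors. The form $f$ is perfect if it is positive definite and it is the only quadratic form $g\in Sym(n,\mathbb{R})$ satisfying $g(v)=m$ for all minimal vectors $v$ of $f$. The perfect domain of a perfect form $f$ is the $N$-dimensional polyhedral cone in $Sym(n,\mathbb{R})$ consisting of the nonnegative linear combinations of the rank one forms $x\mapsto (v\cdot x)^2$, where $v$ runs over the minimal vectors of $f$ and $\cdot$ is the standard scalar product. A wall of an $N$-dimensional polyhedral cone is a facet, i.e. a face of dimension $N-1$; a common wall of two (distinct) domains is a cone that is a facet of each of them. Equivalence. Two forms $f,g$ are equivalent if, up to a positive scalar factor, $g(x)=f(Ux)$ for some $U\in GL(n,\mathbb{Z})$. A perfect domain of type $D_n$ is the perfect domain of a perfect form equivalent to the Gram form of the root lattice $D_n=\{x\in\mathbb{Z}^n:\sum_i x_i \text{ even}\}$. $E_6^*$ denotes (the Gram form of) the dual lattice of the root lattice $E_6$. $\phi_2^5$ denotes the third perfect form of Korkine and Zolotareff in $5$ variables, i.e. the form of Coxeter's lattice $A_5^{3}$, the lattice containing the root lattice $A_5$ with index $3$ and contained in the dual lattice $A_5^*$. The cone $TW(n)$. Let $S_n$ be the simplex in $\mathbb{Z}^n$ whose $n+1$ vertices are $0$,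 the standard basis vectors $e_1,\dots,e_{n-1}$, and $(1,\dots,1,-(n-3))^T$. Its $(0,1)$-dual is $S_n^0=\{u\in\mathbb{Z}^n: u\cdot s\in\{0,1\}\text{ for every vertex } s\text{ of }S_n\}$. Explicitly, $S_n^0$ consists of the zero vector; the $n-1$ vectors $e_1,\dots,e_{n-1}$; all vectors with last coordinate $1$ and, among the first $n-1$ coordinates, exactly $n-2$ ones and one zero; and all vectors with last coordinate $1$ and, among the first $n-1$ coordinates, exactly $n-3$ ones and two zeros. $TW(n)\subset Sym(n,\mathbb{R})$ is the cone of all nonnegative linear combinations of the rank one forms $x\mapsto(u\cdot x)^2$, $u\in S_n^0$.
   Formalization: S_n^0 is taken to be the explicit list of vectors given with its definition; for n=5 the (0,1)-dual condition also admits (1,1,1,1,2), and with that vector TW(5) would have dimension 15=N and could not be a wall. For n>5 the two descriptions agree. *)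

(* Defs.v *)
From HB Require Import structures.
From mathcomp Require Import all_boot all_order all_algebra.
From mathcomp Require Import boolp classical_sets reals.

Set Implicit Arguments.
Unset Strict Implicit.
Unset Printing Implicit Defensive.

Import Order.TTheory GRing.Theory Num.Theory.

Local Open Scope ring_scope.
Local Open Scope classical_set_scope.

(* A quadratic form in n variables is represented by its symmetric matrix, a
   vector by a column. *)

Section Cones.
Variables (R : realType) (V : vectType R).
Implicit Types (S C F : set V).

Definition conic_hull S : set V :=
  [set x | exists s : seq (R * V),
     (forall p, p \in s -> 0 <= p.1 /\ S p.2) /\
     x = \sum_(p <- s) p.1 *: p.2].

Definition polyhedral_cone C : Prop :=
  exists s : seq V, C = conic_hull [set` s].

Definition linear_hull S (W : {vspace V}) : Prop :=
  (forall x, S x -> x \in W) /\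
  (forall W' : {vspace V}, (forall x, S x -> x \in W') -> (W <= W')%VS).

Definition cone_dim C (d : nat) : Prop :=
  exists2 W : {vspace V}, linear_hull C W & \dim W = d.

Definition face C F : Prop :=
  exists l : {scalar V},
    (forall x, C x -> 0 <= l x) /\ F = [set x | C x /\ l x = 0].

(* F is a facet of the d-dimensional polyhedral cone C. *)
Definition wall (d : nat) C F : Prop :=
  [/\ polyhedral_cone C, cone_dim C d, face C F & cone_dim F d.-1].

Definition common_wall (d : nat) (C1 C2 F : set V) : Prop :=
  [/\ C1 <> C2, wall d C1 F & wall d C2 F].

End Cones.

Section Forms.
Variables (R : realType) (n : nat).
Implicit Types (A B : 'M[R]_n) (v w : 'cV[int]_n).

Definition int_mx (p q : nat) (M : 'M[int]_(p, q)) : 'M[R]_(p, q) :=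
  map_mx intr M.

Definition qform A (x : 'cV[R]_n) : R := (x^T *m A *m x) 0 0.

Definition posdef A : Prop :=
  A^T = A /\ forall x : 'cV[R]_n, x != 0 -> 0 < qform A x.

Definition arith_min A (m : R) : Prop :=
  (exists2 v, v != 0 & qform A (int_mx v) = m) /\
  (forall v, v != 0 -> m <= qform A (int_mx v)).

Definition min_vectors A : set 'cV[int]_n :=
  [set v | exists2 m, arith_min A m & qform A (int_mx v) = m].

Definition perfect A : Prop :=
  posdef A /\
  exists2 m, arith_min A m &
    forall B, B^T = B ->
      (forall v, min_vectors A v -> qform B (int_mx v) = m) -> B = A.

(* The matrix of the rank one form x |-> (v . x)^2. *)
Definition rank_one v : 'M[R]_n := int_mx v *m (int_mx v)^T.

Definition perfect_domain A : set 'M[R]_n :=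
  conic_hull [set rank_one v | v in min_vectors A].

Definition equivalent A B : Prop :=
  exists (c : R) (U : 'M[int]_n),
    [/\ 0 < c, U \in unitmx & B = c *: ((int_mx U)^T *m A *m int_mx U)].

End Forms.

Section Lattices.
Variable R : realType.

(* The columns of B form a Z-basis of L and A is their Gram matrix. *)
Definition gram_form (k n : nat) (L : set 'cV[R]_k) (A : 'M[R]_n) : Prop :=
  exists B : 'M[R]_(k, n),
    [/\ \rank B = n,
        L = [set B *m int_mx R z | z in [set: 'cV[int]_n]] &
        A = B^T *m B].

Definition dual_lattice (k : nat) (L : set 'cV[R]_k) : set 'cV[R]_k :=
  [set y : 'cV[R]_k | (exists2 W, linear_hull L W & y \in W) /\
           (forall x, L x -> (y^T *m x) 0 0 \is a Num.int)].

(* The subgroup M of L has index h: the w i represent the cosets of M in L. *)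
Definition has_index (k : nat) (L M : set 'cV[R]_k) (h : nat) : Prop :=
  M `<=` L /\
  exists w : 'I_h -> 'cV[R]_k,
    (forall i, L (w i)) /\ (forall x, L x -> exists! i, M (x - w i)).

Definition even_sum (k : nat) (x : 'cV[R]_k) : Prop :=
  exists z : int, \sum_i x i 0 = (2 * z)%:~R.

Definition A_lattice (k : nat) : set 'cV[R]_k.+1 :=
  [set x : 'cV[R]_k.+1 | (forall i, x i 0 \is a Num.int) /\ \sum_i x i 0 = 0].

Arguments A_lattice k : clear implicits.

Definition D_lattice (k : nat) : set 'cV[R]_k :=
  [set x : 'cV[R]_k | (forall i, x i 0 \is a Num.int) /\ even_sum x].

Arguments D_lattice k : clear implicits.

Definition E8_lattice : set 'cV[R]_8 :=
  [set x : 'cV[R]_8 | ((forall i, x i 0 \is a Num.int) \/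
            (forall i, x i 0 - 2^-1 \is a Num.int)) /\ even_sum x].

(* The vectors of E_8 with equal last three coordinates, that is, orthogonal
   to a root sublattice A_2. *)
Definition E6_lattice : set 'cV[R]_8 :=
  [set x : 'cV[R]_8 | E8_lattice x /\
     forall i j : 'I_8, (5 <= i)%N -> (5 <= j)%N -> x i 0 = x j 0].

(* L satisfies the conditions that single out Coxeter's lattice A_5^3; that L
   is a lattice is part of [gram_form]. *)
Definition coxeter_A5_3 (L : set 'cV[R]_6) : Prop :=
  has_index L (A_lattice 5) 3 /\ L `<=` dual_lattice (A_lattice 5).

Definition is_phi25 (A : 'M[R]_5) : Prop :=
  exists2 L, coxeter_A5_3 L & gram_form L A.

Definition is_E6_dual (A : 'M[R]_6) : Prop :=
  gram_form (dual_lattice E6_lattice) A.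

Definition domain_of_type_D (n : nat) (C : set 'M[R]_n) : Prop :=
  exists G A : 'M[R]_n,
    [/\ gram_form (D_lattice n) G, equivalent G A, perfect A &
        C = perfect_domain A].

End Lattices.

(* The explicit list of the vectors of S_n^0. Z is the set of the vanishing
   coordinates of the vectors with last coordinate 1. For n > 5 the list is the
   whole (0,1)-dual of the simplex S_n; for n = 5 that dual contains in
   addition (1,1,1,1,2), which must be left out: with it the cone would have
   full dimension. *)
Definition simplex_dual (n : nat) : set 'cV[int]_n :=
  [set u : 'cV[int]_n |
     [\/ u = 0,
         exists2 i : 'I_n, (i.+1 < n)%N & u = delta_mx i 0 |
         exists Z : {set 'I_n},
           [/\ forall i, i \in Z -> (i.+1 < n)%N,
               #|Z| = 1%N \/ #|Z| = 2%N &
               u = \col_i (i \notin Z)%:Z]]].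

Arguments simplex_dual n : clear implicits.

Definition TW (R : realType) (n : nat) : set 'M[R]_n :=
  conic_hull [set rank_one R u | u in simplex_dual n].

Arguments TW R n : clear implicits.

Definition TF (R : realType) (n : nat) : 'M[R]_n :=
  let t : R := n%:R in
  \matrix_(i, j)
    if ~~ odd n then
      if (i.+1 == n) && (j.+1 == n) then t ^+ 2 / 2 - 7 / 2 * t + 7
      else if (i.+1 == n) || (j.+1 == n) then
        - ((t ^+ 2 - 6 * t + 10) / (2 * (t - 2)))
      else if i == j then 1
      else (t - 4) / (2 * (t - 2))
    else
      if (i.+1 == n) && (j.+1 == n) then
        (t ^+ 3 - 8 * t ^+ 2 + 23 * t - 20) / (2 * (t - 1))
      else if (i.+1 == n) || (j.+1 == n) then
        - ((t ^+ 2 - 5 * t + 8) / (2 * (t - 1)))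
      else if i == j then 1
      else (t - 3) / (2 * (t - 1)).

(* Main.v *)
Require Import Defs.
From HB Require Import structures.
From mathcomp Require Import all_boot all_order all_algebra.
From mathcomp Require Import boolp classical_sets reals cardinality.
From mathcomp Require Import zify ring lra.

Set Implicit Arguments.
Unset Strict Implicit.
Unset Printing Implicit Defensive.

Import Order.TTheory GRing.Theory Num.Theory.

(** Write [k = n - 1] and [h = k / 2], rounded down.  For an integral vector [x]
    with last coordinate [t], put [z_i = x_i - t], [s = sum z_i] and
    [r = s + 2 t].  The symmetric forms with value 1 at the nonzero vectors of the
    simplex dual form a pencil ([TW_rigid]).  Two members of the pencil matter:
    [(|z|^2 + r^2) / 2], which is half the norm of D_n because [(z, r)] runs over
    the vectors with even coordinate sum, and TF, for which
      [4 h TF = (2 h + 2) |z|^2 + (2 h - 1) r^2 - s^2]   ([qform_TF]).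
    Both have arithmetic minimum 1, which for TF is the inequality
    [minimum_inequality] between integers.  If both take the value 1 at [x],
    then [|z|^2 + r^2 = 2] and [|s| = |z|^2], which leaves only the nonzero vectors
    of the simplex dual and their opposites ([min_simplex_dual]).  Each of the two
    forms has a further minimal vector, at which the other form is larger than
    1: [e_i - e_j] for D_n, and the vector with [t = h] and [z_i = -1] for [i < n]
    for TF.

    The rest is a general principle ([common_wall_of_pencil]).  Let [A] and [B] be
    positive definite forms with the same minimum spanning a pencil that is cut
    out by their common minimal vectors, each form having a minimal vector that is
    not minimal for the other.  Then both are perfect, since the extra minimal
    vector fixes the parameter of the pencil.  The functional [trace ((B - A) X)]
    is nonnegative on the domain of [A], nonpositive on the domain of [B], and the
    generators of either domain at which it vanishes are the common minimal
    vectors.  So the cone over these is a face of both domains.  Its dimension is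
    found by duality: a symmetric form annihilating the common minimal vectors is
    a multiple of [B - A], so that their rank one forms span a hyperplane of the
    space of symmetric matrices.

    For [n = 5] and [n = 6], explicit bases of Coxeter's lattice and of the dual of
    E_6 have the Gram matrix [4/3 TF].  The first lattice consists of the vectors
    with sum 0 and pairwise congruent coordinates in [Z / 3], and the class of the
    coordinates modulo 1 separates the cosets of A_5; the second is recognized
    through the dual basis, which lies in E_6. *)

(** * Conic hulls and linear hulls *)

Section Hulls.
Local Open Scope ring_scope.
Local Open Scope classical_set_scope.
Variables (R : realType) (V : vectType R).
Implicit Types (S : set V) (W : {vspace V}).

Lemma conic_hull_sub S S' : S `<=` conic_hull S' -> conic_hull S `<=` conic_hull S'.
Proof.
move=> sub x [s [Hs ->]]; elim: s Hs => [|[a v] s IH] Hs.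
  by exists [::]; rewrite !big_nil.
have [|t [Ht Et]] := IH; first by move=> p ps; apply: Hs; rewrite inE ps orbT.
have [a0 /sub [u [Hu Eu]]] := Hs (a, v) (mem_head _ _).
exists ([seq (a * p.1, p.2) | p <- u] ++ t); split.
  move=> p; rewrite mem_cat => /orP[/mapP[q /Hu [q0 Sq] ->]|/Ht //].
  by split=> //=; rewrite mulr_ge0.
move: Eu => /= Eu.
rewrite big_cons big_cat big_map Et /= Eu scaler_sumr; congr (_ + _).
by apply: eq_bigr => p _; rewrite scalerA.
Qed.

Lemma mem_conic_hull S x : S x -> conic_hull S x.
Proof.
move=> Sx; exists [:: (1, x)]; rewrite big_seq1 scale1r; split=> // p.
by rewrite inE => /eqP ->; split=> //=; exact: ler01.
Qed.

Lemma conic_hull0 S : conic_hull S 0.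
Proof. by exists [::]; rewrite big_nil. Qed.

Lemma conic_hull_mem_vspace S W x :
  (forall y, S y -> y \in W) -> conic_hull S x -> x \in W.
Proof.
move=> SW [s [Hs ->]]; rewrite big_seq; apply: memv_suml => p /Hs[_ Sp].
exact/memvZ/SW.
Qed.

Lemma finite_polyhedral S : finite_set S -> polyhedral_cone (conic_hull S).
Proof. by move=> /finite_seqP[s ->]; exists s. Qed.

Lemma linear_hull_uniq S W W' : linear_hull S W -> linear_hull S W' -> W = W'.
Proof.
move=> [SW minW] [SW' minW']; apply/eqP; rewrite eqEsubv.
by rewrite minW // minW'.
Qed.

(** A vanishing sum of nonnegative terms vanishes termwise. *)
Lemma face_conic_hull S (l : {scalar V}) :
  (forall x, S x -> 0 <= l x) ->
  face (conic_hull S) (conic_hull [set x | S x /\ l x = 0]).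
Proof.
move=> l0; exists l; split=> [x [s [Hs ->]]|].
  rewrite linear_sum big_seq; apply: sumr_ge0 => p /Hs[p0 /l0 lp].
  by rewrite linearZ mulr_ge0.
apply/seteqP; split=> x.
  move=> [s [Hs Ex]]; split.
    by exists s; split=> // p /Hs[? []].
  rewrite Ex linear_sum big_seq big1 // => p /Hs[_ [_ lp]].
  by rewrite linearZ /= lp mulr0.
move=> [[s [Hs Ex]] lx].
exists [seq p <- s | l p.2 == 0]; split.
  by move=> p; rewrite mem_filter => /andP[/eqP lp /Hs[? ?]].
rewrite Ex (bigID (fun p => l p.2 == 0)) /= big_filter -[RHS]addr0.
congr (_ + _); rewrite big_seq_cond big1 // => p /andP[ps lp].
have pos q : q \in s -> 0 <= q.1 * l q.2.
  by move=> /Hs[q0 /l0 lq]; rewrite mulr_ge0.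
move: lx; rewrite Ex linear_sum.
under eq_bigr do rewrite linearZ /=.
move=> /eqP; rewrite big_seq psumr_eq0 // => /allP /(_ p ps).
by rewrite ps /= mulf_eq0 (negPf lp) orbF => /eqP ->; rewrite scale0r.
Qed.

End Hulls.

(** * The space of symmetric matrices *)

Section SymmetricMatrices.
Local Open Scope ring_scope.
Local Open Scope classical_set_scope.
Variables (R : realType) (n : nat).
Implicit Types (A E F X : 'M[R]_n).

Definition trace_form A X : R := \tr (A *m X).

Lemma trace_form_is_scalar A : scalar (trace_form A).
Proof. by move=> a X Y; rewrite /trace_form mulmxDr -scalemxAr mxtraceD mxtraceZ. Qed.

HB.instance Definition _ A :=
  GRing.isLinear.Build R 'M[R]_n R *%R (trace_form A) (trace_form_is_scalar A).

(** In [R^o] the field is seen as a vector space over itself, so that the kernel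
    and the image of the form are subspaces. *)
Definition trace_hom A : 'Hom('M[R]_n, R^o) := linfun (trace_form A : 'M[R]_n -> R^o).

Lemma trace_homE A X : trace_hom A X = trace_form A X.
Proof. by rewrite lfunE. Qed.

Lemma trace_form_tr A X : trace_form A^T X = trace_form A X^T.
Proof. by rewrite /trace_form -mxtrace_tr trmx_mul trmxK mxtrace_mulC. Qed.

Lemma trace_formBl A A' X : trace_form (A - A') X = trace_form A X - trace_form A' X.
Proof. by rewrite /trace_form mulmxBl raddfB. Qed.

Lemma trace_formZl a A X : trace_form (a *: A) X = a * trace_form A X.
Proof. by rewrite /trace_form -scalemxAl mxtraceZ. Qed.

Lemma trace_formDl A A' X : trace_form (A + A') X = trace_form A X + trace_form A' X.
Proof. by rewrite /trace_form mulmxDl raddfD. Qed.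

(** Some entry of [X] minus its projection to [W] is nonzero, and every linear
    functional, such as this entry, is a trace form. *)
Lemma trace_form_separation (W : {vspace 'M[R]_n}) X : X \notin W ->
  exists F, (forall Y, Y \in W -> trace_form F Y = 0) /\ trace_form F X != 0.
Proof.
move=> XW; pose h Y : 'M[R]_n := Y - projv W Y.
have hX : h X != 0.
  by apply: contraNneq XW => /subr0_eq ->; exact: memv_proj.
have [i [j hij]] : exists i j, h X i j != 0.
  apply: contrapT => H; case/eqP: hX; apply/matrixP => i j; rewrite [RHS]mxE.
  by apply/eqP/negPn/negP => hij; apply: H; exists i, j.
pose F := \matrix_(b, a) h (delta_mx a b) i j.
have hF Y : trace_form F Y = h Y i j.
  have -> : h Y = \sum_a \sum_b Y a b *: h (delta_mx a b).
    rewrite {1}[Y]matrix_sum_delta /h linear_sum -sumrB; apply: eq_bigr => a _.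
    rewrite linear_sum -sumrB; apply: eq_bigr => b _.
    by rewrite linearZ scalerBr.
  rewrite /trace_form mxtrace_mulC /mxtrace summxE; apply: eq_bigr => a _.
  rewrite summxE mxE; apply: eq_bigr => b _.
  by rewrite !mxE.
exists F; split=> [Y YW|]; last by rewrite hF.
by rewrite hF /h projv_id // subrr mxE.
Qed.

Definition sym_space : {vspace 'M[R]_n} :=
  lker (linfun (@trmx R n n) - \1)%VF.

Lemma mem_sym_space X : (X \in sym_space) = (X^T == X).
Proof. by rewrite memv_ker add_lfunE opp_lfunE !lfunE /= subr_eq0. Qed.

(** A smaller space containing [S] would be separated from [W] by a trace form,
    and on symmetric matrices the matrix of a trace form can be symmetrized. *)
Lemma linear_hull_conic_hull (S : set 'M[R]_n) (W : {vspace 'M[R]_n}) :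
  (W <= sym_space)%VS -> (forall X, S X -> X \in W) ->
  (forall E X, E^T = E -> X \in W -> (forall Y, S Y -> trace_form E Y = 0) ->
     trace_form E X = 0) ->
  linear_hull (conic_hull S) W.
Proof.
move=> Wsym SW dual; split=> [X|W' SW']; first exact: conic_hull_mem_vspace.
apply/subvP => X XW; apply/negPn/negP => XW'.
have [F [FW' FX]] : exists F,
    (forall Y, Y \in (W' :&: W)%VS -> trace_form F Y = 0) /\ trace_form F X != 0.
  by apply: trace_form_separation; rewrite memv_cap negb_and XW'.
have dbl Y : Y \in W -> trace_form (F + F^T) Y = 2 * trace_form F Y.
  move=> /(subvP Wsym); rewrite mem_sym_space => /eqP symY.
  by rewrite trace_formDl trace_form_tr symY mulr_natl mulr2n.
have : trace_form (F + F^T) X = 0.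
  apply: dual => // [|Y SY]; first by rewrite linearD /= trmxK addrC.
  rewrite dbl ?SW // FW' ?mulr0 // memv_cap SW // andbT.
  exact/SW'/mem_conic_hull.
by apply/eqP; rewrite dbl // mulf_neq0 // pnatr_eq0.
Qed.

Lemma card_upper : #|{: {p : 'I_n * 'I_n | (p.1 <= p.2)%N}}| = (n * n.+1)./2.
Proof.
rewrite card_sig -sum1_card /=.
rewrite -(pair_big_dep xpredT (fun i j : 'I_n => (i <= j)%N) (fun _ _ => 1%N)) /=.
rewrite (exchange_big_dep xpredT) //=.
under eq_bigr => j _ do rewrite (big_ord_narrow (ltn_ord j)) sum1_card card_ord.
rewrite -(big_mkord xpredT succn) -(big_add1 _ _ _ n.+1 xpredT id) mulnC.
by rewrite -(bin2 n.+1) -bin2_sum [RHS]big_ltn.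
Qed.

Definition upper_part X : {ffun {p : 'I_n * 'I_n | (p.1 <= p.2)%N} -> R^o} :=
  [ffun p => X (val p).1 (val p).2].

Lemma upper_part_is_linear : linear upper_part.
Proof. by move=> a X Y; apply/ffunP => p; rewrite !ffunE !mxE. Qed.

HB.instance Definition _ := GRing.isLinear.Build R 'M[R]_n _ _ upper_part
  upper_part_is_linear.

(** The upper triangular part of a symmetric matrix is arbitrary and determines
    the matrix. *)
Lemma dim_sym_space : \dim sym_space = (n * n.+1)./2.
Proof.
rewrite -card_upper -(@limg_dim_eq _ _ _ (linfun upper_part)).
  have -> : (linfun upper_part @: sym_space)%VS = fullv.
    apply/eqP; rewrite eqEsubv subvf /=; apply/subvP => u _.
    pose X : 'M[R]_n := \matrix_(i, j)
      (if insub (i, j) is Some p then u p else if insub (j, i) is Some p then u p else 0).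
    have -> : u = linfun upper_part X.
      by rewrite lfunE; apply/ffunP => -[[i j] ij]; rewrite ffunE mxE insubT.
    apply: memv_img; rewrite mem_sym_space; apply/eqP/matrixP => i j; rewrite !mxE.
    case: insubP => [p pij vp|_]; case: insubP => [q qij vq|_] //.
    congr (u _); apply: val_inj; rewrite vp vq.
    by congr (_, _); apply/val_inj/eqP; rewrite eqn_leq pij qij.
  by rewrite dimvf /dim /= muln1.
apply/eqP; rewrite -subv0; apply/subvP => X; rewrite memv_cap mem_sym_space memv_ker.
move=> /andP[/eqP symX /eqP]; rewrite lfunE /= memv0 => /ffunP X0.
have up (i j : 'I_n) : (i <= j)%N -> X i j = 0.
  by move=> ij; have := X0 (exist _ (i, j) ij); rewrite !ffunE.
apply/eqP/matrixP => i j; rewrite [RHS]mxE.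
by case/orP: (leq_total i j) => /up //; rewrite -{2}symX mxE.
Qed.

End SymmetricMatrices.

(** * Minimal vectors of positive definite forms *)

Section PositiveForms.
Local Open Scope ring_scope.
Local Open Scope classical_set_scope.
Variables (R : realType) (n : nat).
Implicit Types (A B E : 'M[R]_n) (x y : 'cV[R]_n) (v w : 'cV[int]_n).

Lemma qform_trace_form A v : qform A (int_mx R v) = trace_form A (rank_one R v).
Proof.
by rewrite /qform /trace_form /rank_one mulmxA mxtrace_mulC mulmxA -trace_mx11.
Qed.

Lemma rank_one_sym v : (rank_one R v)^T = rank_one R v.
Proof. by rewrite trmx_mul trmxK. Qed.

Lemma rank_oneN v : rank_one R (- v) = rank_one R v.
Proof. by rewrite /rank_one /int_mx map_mxN [(- _)^T]linearN /= mulNmx mulmxN opprK. Qed.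

Lemma rank_one0 : rank_one R (0 : 'cV[int]_n) = 0.
Proof. by rewrite /rank_one /int_mx map_mx0 mul0mx. Qed.

Lemma qformE A x : qform A x = \sum_i \sum_j A i j * (x i 0 * x j 0).
Proof.
rewrite /qform mxE exchange_big /=; apply: eq_bigr => j _.
rewrite mxE mulr_suml; apply: eq_bigr => i _; rewrite mxE; ring.
Qed.

Lemma qformB A x y : A^T = A ->
  qform A (x - y) = qform A x - 2 * (y^T *m A *m x) 0 0 + qform A y.
Proof.
move=> symA; rewrite /qform [(_ - _)^T]linearB /= !mulmxBl !mulmxBr.
have -> : x^T *m A *m y = y^T *m A *m x.
  transitivity (x^T *m A *m y)^T; last by rewrite !trmx_mul trmxK symA mulmxA.
  by apply/matrixP => i j; rewrite !ord1 [RHS]mxE.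
rewrite !mxE; ring.
Qed.

Lemma qformZ A a x : qform A (a *: x) = a ^+ 2 * qform A x.
Proof. by rewrite /qform [(_ *: _)^T]linearZ /= -!scalemxAl -scalemxAr !mxE mulrA. Qed.

Lemma posdefZ a A : 0 < a -> posdef A -> posdef (a *: A).
Proof.
move=> a0 [symA posA]; split=> [|x /posA Ax]; first by rewrite linearZ /= symA.
by rewrite /qform -scalemxAr -scalemxAl mxE mulr_gt0.
Qed.

Lemma posdef_unit A : posdef A -> A \in unitmx.
Proof.
move=> [symA posA]; rewrite -row_free_unit -kermx_eq0; apply/eqP/row_matrixP => i.
rewrite row0; apply/eqP/negPn/negP => nz.
have /posA : (row i (kermx A))^T != 0 by rewrite trmx_eq0.
rewrite /qform trmxK -row_mul mulmx_ker row0 mul0mx mxE ltxx //.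
Qed.

(** Cauchy-Schwarz for the scalar product defined by [A], applied to [x] and to
    the vector that represents the [i]-th coordinate. *)
Lemma posdef_coord_bound A : posdef A ->
  exists2 c : R, 0 <= c & forall x i, x i 0 ^+ 2 <= c * qform A x.
Proof.
move=> pdA; have [symA posA] := pdA; have Au := posdef_unit pdA.
have pos0 x : 0 <= qform A x.
  by have [->|/posA/ltW//] := eqVneq x 0; rewrite /qform mulmx0 mxE.
pose y i : 'cV[R]_n := invmx A *m delta_mx i 0.
have yx i x : ((y i)^T *m A *m x) 0 0 = x i 0.
  rewrite /y trmx_mul trmx_inv symA mulmxKV // trmx_delta -rowE.
  by rewrite mxE.
have CS i x : x i 0 ^+ 2 <= qform A (y i) * qform A x.
  have [y0|ypos] := leP (qform A (y i)) 0.
    have {}y0 : y i = 0 by apply/eqP/negPn/negP => /posA; rewrite ltNge y0.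
    by rewrite -yx y0 linear0 !mul0mx /qform trmx0 !mul0mx mxE expr0n mul0r.
  have := pos0 (qform A (y i) *: x - x i 0 *: y i).
  rewrite qformB // !qformZ [(_ *: _)^T]linearZ /= -!scalemxAl -scalemxAr.
  have scal (a : R) (M : 'M[R]_1) : (a *: M) 0 0 = a * M 0 0 by rewrite mxE.
  rewrite !scal yx => H.
  rewrite -subr_ge0 -(pmulr_rge0 _ ypos); apply: le_trans H _.
  by rewrite le_eqVlt; apply/orP; left; apply/eqP; ring.
exists (\sum_i qform A (y i)); first exact: sumr_ge0.
move=> x i; apply: le_trans (CS i x) _; apply: ler_wpM2r => //.
by rewrite (bigD1 i) //= lerDl sumr_ge0.
Qed.

Lemma min_vectorsE A m v : arith_min A m -> min_vectors A v = (qform A (int_mx R v) = m).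
Proof.
move=> mA; apply/propext; split=> [[m' mA' ->]|]; last by exists m.
have [[w w0 qw] minm] := mA; have [[w' w0' qw'] minm'] := mA'.
by apply/eqP; rewrite eq_le -{1}qw minm' // -qw' minm.
Qed.

(** The coordinates of the minimal vectors are bounded. *)
Lemma finite_min_vectors A : posdef A -> finite_set (min_vectors A).
Proof.
move=> /posdef_coord_bound[c c0 bound].
have [[m mA]|nm] := pselect (exists m, arith_min A m); last first.
  by apply: (@sub_finite_set _ _ set0) => // v [m mA _]; case: nm; exists m.
pose K := Num.truncn (c * m).
pose f (u : {ffun 'I_n -> 'I_(K.*2.+1)}) : 'cV[int]_n := \col_i ((u i : nat)%:Z - K%:Z).
apply: (@sub_finite_set _ _ (f @` setT)); last exact/finite_image/finite_finset.
move=> v; rewrite (min_vectorsE _ mA) => qv.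
have vK i : (`|v i 0| <= K%:Z)%R.
  have : (v i 0)%:~R ^+ 2 <= c * m :> R by have := bound (int_mx R v) i; rewrite qv mxE.
  rewrite -rmorphXn /= => b.
  have {b} : (absz (v i ord0 ^+ 2) <= K)%N.
    rewrite truncn_ge_nat; last by apply: le_trans b; rewrite ler0z sqr_ge0.
    by rewrite natr_absz ger0_norm ?sqr_ge0.
  rewrite abszX => sqK; have [->|v0] := eqVneq (v i 0) 0; first by rewrite normr0.
  suff : (absz (v i 0%R) <= K)%N by lia.
  by apply: leq_trans sqK; rewrite leq_pmull // absz_gt0.
exists [ffun i => inord (absz (v i 0 + K%:Z))] => //.
apply/colP => i; rewrite mxE ffunE inordK; have := vK i; lia.
Qed.

(** The symmetric forms vanishing on the minimal vectors form the annihilator of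
    their rank one forms; for a perfect form it is zero. *)
Lemma linear_hull_perfect_domain A : perfect A ->
  linear_hull (perfect_domain A) (sym_space R n).
Proof.
move=> [[symA posA] [m mA perfA]]; apply: linear_hull_conic_hull => //.
  by move=> _ [v _ <-]; rewrite mem_sym_space rank_one_sym.
move=> E X symE _ EA; suff -> : E = 0 by rewrite /trace_form mul0mx mxtrace0.
have: E + A = A; last by move/eqP; rewrite -subr_eq0 addrK => /eqP.
apply: perfA => [|v minv]; first by rewrite linearD /= symE symA.
rewrite !qform_trace_form trace_formDl EA ?add0r; last by exists v.
by rewrite -qform_trace_form -(min_vectorsE _ mA).
Qed.

End PositiveForms.

(** * Two perfect forms sharing a wall *)

Section CommonWall.
Local Open Scope ring_scope.
Local Open Scope classical_set_scope.
Variables (R : realType) (n : nat).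
Implicit Types (A B E : 'M[R]_n) (v w : 'cV[int]_n).

(** The functional [X |-> trace ((B - A) X)] is nonnegative on the minimal
    vectors of [A], because those have value at least [m] under [B]; it
    vanishes exactly on the common minimal vectors.  The space spanned by
    these is the annihilator of [B - A] alone, hence a hyperplane. *)
Lemma wall_of_neighbour A B (m : R) (T : set 'cV[int]_n) :
  perfect A -> posdef B -> arith_min A m -> arith_min B m ->
  (forall v, T v -> v = 0 \/ min_vectors A v /\ min_vectors B v) ->
  (forall v, min_vectors A v -> min_vectors B v -> T v \/ T (- v)) ->
  (forall E, E^T = E -> (forall v, T v -> qform E (int_mx R v) = 0) ->
     exists c, E = c *: (B - A)) ->
  (exists2 v, min_vectors A v & ~ min_vectors B v) ->
  wall (n * n.+1)./2 (perfect_domain A) (conic_hull [set rank_one R v | v in T]).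
Proof.
move=> perfA posB mA mB Tmin minT annT [v0 minv0 neqv0].
have posA : posdef A by case: perfA.
set l : {scalar 'M[R]_n} := trace_form (B - A).
have lE v : l (rank_one R v) = qform B (int_mx R v) - qform A (int_mx R v).
  by rewrite /= trace_formBl !qform_trace_form.
have l0 X : [set rank_one R v | v in min_vectors A] X -> 0 <= l X.
  move=> [v minv <-]; rewrite lE subr_ge0.
  have [->|nz] := eqVneq v 0; first by rewrite !qform_trace_form rank_one0 !linear0.
  by move: minv; rewrite (min_vectorsE _ mA) => ->; case: mB => _; exact.
have lT X : [set rank_one R v | v in T] X -> l X = 0.
  move=> [v /Tmin minv <-]; rewrite lE.
  case: minv => [->|[]]; first by rewrite !qform_trace_form rank_one0 !linear0 subr0.
  by rewrite (min_vectorsE _ mA) (min_vectorsE _ mB) => -> ->; rewrite subrr.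
have faceE : conic_hull [set rank_one R v | v in T] =
    conic_hull [set X | [set rank_one R v | v in min_vectors A] X /\ l X = 0].
  apply/seteqP; split; apply: conic_hull_sub => X.
    move=> TX; have lX := lT X TX; case: TX lX => v Tv <- lX.
    have [->|[minv _]] := Tmin v Tv; first by rewrite rank_one0; exact: conic_hull0.
    by apply: mem_conic_hull; split=> //; exists v.
  move=> [[v minv <-]]; rewrite lE => /subr0_eq BA; apply: mem_conic_hull.
  have minBv : min_vectors B v.
    by move: minv; rewrite (min_vectorsE _ mA) (min_vectorsE _ mB) BA.
  have [Tv|Tv] := minT v minv minBv; first by exists v.
  by exists (- v) => //; exact: rank_oneN.
split.
- exact/finite_polyhedral/finite_image/finite_min_vectors.
- exists (sym_space R n); first exact: linear_hull_perfect_domain.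
  exact: dim_sym_space.
- by rewrite faceE; exact: face_conic_hull.
exists (sym_space R n :&: lker (trace_hom (B - A)))%VS.
  apply: linear_hull_conic_hull; first exact: capvSl.
    move=> X TX; rewrite memv_cap memv_ker trace_homE lT // eqxx andbT.
    by case: TX => v _ <-; rewrite mem_sym_space rank_one_sym.
  move=> E X symE; rewrite memv_cap memv_ker trace_homE => /andP[_ /eqP lX] ET.
  have [v Tv|c ->] := annT E symE; first by rewrite qform_trace_form ET //; exists v.
  by rewrite trace_formZl lX mulr0.
have := limg_ker_dim (trace_hom (B - A)) (sym_space R n); rewrite dim_sym_space => <-.
suff -> : \dim (trace_hom (B - A) @: sym_space R n) = 1%N by rewrite addn1.
have v0S : rank_one R v0 \in sym_space R n by rewrite mem_sym_space rank_one_sym.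
have lv0 : trace_hom (B - A) (rank_one R v0) != 0.
  rewrite trace_homE lE subr_eq0; move: neqv0 minv0.
  by rewrite (min_vectorsE _ mA) (min_vectorsE _ mB) => neq ->; exact/eqP.
apply/eqP; rewrite eqn_leq; apply/andP; split; first by rewrite -[1%N]/(dim R^o) -dimvf dimvS ?subvf.
rewrite lt0n dimv_eq0; apply: contraNneq lv0 => img0.
by rewrite -memv0 -img0 memv_img.
Qed.

(** By the last hypothesis, a symmetric form vanishing on [T] is determined by its
    value at [w], so it is a multiple of [B - A].  As [B - A] vanishes neither at
    [v] nor at [w], both forms are perfect. *)
Lemma common_wall_of_pencil A B (m : R) (T : set 'cV[int]_n) v w :
  posdef A -> posdef B -> arith_min A m -> arith_min B m ->
  (forall v, T v -> v = 0 \/ min_vectors A v /\ min_vectors B v) ->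
  (forall v, min_vectors A v -> min_vectors B v -> T v \/ T (- v)) ->
  min_vectors A v -> ~ min_vectors B v ->
  min_vectors B w -> ~ min_vectors A w ->
  (forall E, E^T = E -> (forall u, T u -> qform E (int_mx R u) = 0) ->
     qform E (int_mx R w) = 0 -> E = 0) ->
  [/\ perfect A, perfect B &
      common_wall (n * n.+1)./2 (perfect_domain B) (perfect_domain A)
        (conic_hull [set rank_one R u | u in T])].
Proof.
move=> posA posB mA mB Tmin minT Av nBv Bw nAw rigid.
have [[symA _] [symB _]] := (posA, posB).
have qB E F u : qform (E - F) (int_mx R u) = qform E (int_mx R u) - qform F (int_mx R u).
  by rewrite !qform_trace_form trace_formBl.
have qZ a E u : qform (a *: E) (int_mx R u) = a * qform E (int_mx R u).
  by rewrite !qform_trace_form trace_formZl.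
have symBE E F : E^T = E -> F^T = F -> (E - F)^T = E - F.
  by move=> symE symF; rewrite linearB /= symE symF.
have T0 u : T u -> qform (B - A) (int_mx R u) = 0.
  move=> /Tmin[->|[]]; first by rewrite qform_trace_form rank_one0 linear0.
  by rewrite (min_vectorsE _ mA) (min_vectorsE _ mB) qB => -> ->; rewrite subrr.
have wN0 : qform (B - A) (int_mx R w) != 0.
  move: nAw Bw; rewrite (min_vectorsE _ mA) (min_vectorsE _ mB) qB => nA ->.
  by rewrite subr_eq0; apply/eqP => e; exact: nA.
have vN0 : qform (B - A) (int_mx R v) != 0.
  move: nBv Av; rewrite (min_vectorsE _ mA) (min_vectorsE _ mB) qB => nB ->.
  by rewrite subr_eq0; apply/eqP.
have pencil E : E^T = E -> (forall u, T u -> qform E (int_mx R u) = 0) ->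
    exists c, E = c *: (B - A).
  move=> symE ET; set c := qform E (int_mx R w) / qform (B - A) (int_mx R w).
  exists c; apply/subr0_eq/rigid => [|u Tu|].
  - by apply: (symBE) => //; rewrite linearZ /= symBE.
  - by rewrite qB qZ ET // T0 // mulr0 subrr.
  - by rewrite qB qZ /c divfK // subrr.
have perfA : perfect A.
  split=> //; exists m => // E symE minE; apply/subr0_eq.
  have [u Tu|c Ec] := pencil _ (symBE _ _ symE symA).
    rewrite qB; have [->|[Au _]] := Tmin u Tu.
      by rewrite !qform_trace_form rank_one0 !linear0 subrr.
    by rewrite minE //; move: Au; rewrite (min_vectorsE _ mA) => ->; rewrite subrr.
  have := qB E A v; rewrite Ec qZ minE //; move: Av.
  rewrite (min_vectorsE _ mA) => ->; rewrite subrr => /eqP.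
  by rewrite mulf_eq0 (negPf vN0) orbF => /eqP ->; rewrite scale0r.
have perfB : perfect B.
  split=> //; exists m => // E symE minE; apply/subr0_eq/rigid => [|u Tu|].
  - exact: symBE.
  - rewrite qB; have [->|[_ Bu]] := Tmin u Tu.
      by rewrite !qform_trace_form rank_one0 !linear0 subrr.
    by rewrite minE //; move: Bu; rewrite (min_vectorsE _ mB) => ->; rewrite subrr.
  - by rewrite qB minE //; move: Bw; rewrite (min_vectorsE _ mB) => ->; rewrite subrr.
split=> //; split.
(* The two domains lie on opposite sides of the hyperplane of the wall. *)
- move=> eqC; have : perfect_domain A (rank_one R v) by apply: mem_conic_hull; exists v.
  rewrite -eqC => -[s [Hs Es]].
  have : qform (B - A) (int_mx R v) <= 0.
    rewrite qform_trace_form Es linear_sum big_seq; apply: sumr_le0 => p /Hs[p0 [u Bu <-]].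
    rewrite linearZ /= mulr_ge0_le0 // -qform_trace_form qB subr_le0.
    have [->|u0] := eqVneq u 0; first by rewrite !qform_trace_form rank_one0 !linear0.
    by move: Bu; rewrite (min_vectorsE _ mB) => ->; case: mA => _; exact.
  apply/negP; rewrite -ltNge lt_neqAle eq_sym vN0 qB subr_ge0.
  have v0 : v != 0 by apply: contraNneq vN0 => ->; rewrite qform_trace_form rank_one0 linear0.
  by move: Av; rewrite (min_vectorsE _ mA) => ->; case: mB => _; exact.
- apply: wall_of_neighbour mB mA _ _ _ _ => //; [|..|by exists w].
  + by move=> u /Tmin[|[]]; [left|right].
  + by move=> u Bu Au; exact: minT.
  + by move=> E symE /(pencil E symE)[c ->]; exists (- c); rewrite scaleNr -scalerN opprB.
- by apply: wall_of_neighbour mA mB _ _ _ _ => //; exists v.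
Qed.

End CommonWall.

(** * Sums of integers and of their squares *)

Section SumsOfSquares.
Local Open Scope ring_scope.
Variables (I : finType) (P : pred I).

Lemma sqr_sum_le (S : realDomainType) (z : I -> S) :
  (\sum_(i | P i) z i) ^+ 2 <= #|P|%:R * \sum_(i | P i) z i ^+ 2.
Proof.
set s := \sum_(i | P i) z i; set c : S := #|P|%:R.
have [c0|cpos] := posnP #|P|.
  rewrite /s /c c0 mul0r big_pred0 ?expr0n // => i.
  by have := card0_eq c0 i; rewrite unfold_in.
have E : \sum_(i | P i) (c * z i - s) ^+ 2 = c * (c * \sum_(i | P i) z i ^+ 2 - s ^+ 2).
  under eq_bigr do rewrite sqrrB exprMn.
  rewrite big_split sumrB /= sumrMnl -mulr_suml -!mulr_sumr -/s.
  rewrite sumr_const -[_ *+ #|P|]mulr_natl -/c; ring.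
have : 0 <= c * (c * \sum_(i | P i) z i ^+ 2 - s ^+ 2).
  by rewrite -E; apply: sumr_ge0 => i _; exact: sqr_ge0.
by rewrite pmulr_rge0 ?subr_ge0 // ltr0n.
Qed.

Variable z : I -> int.
Let s := \sum_(i | P i) z i.
Let a := \sum_(i | P i) z i ^+ 2.

Lemma sum_sqr_parity : exists q, a = s + 2 * q.
Proof.
rewrite /a /s; elim/big_ind2: _ => [|x y x' y' [q ->] [q' ->]|i _].
- by exists 0.
- by exists (q + q'); ring.
have [q [e|e]] : exists q, z i = 2 * q \/ z i = 2 * q + 1.
  exists (z i %/ 2)%Z; lia.
all: rewrite e.
  by exists (2 * q ^+ 2 - q); ring.
by exists (2 * q ^+ 2 + q); ring.
Qed.

(** Integers satisfy [y (y - 1) >= 0] and [(y - 1) (y - 2) >= 0]. *)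
Lemma sum_sqr_bounds :
  s <= a /\ 3 * s <= a + 2 * #|P|%:Z.
Proof.
split; first by apply: ler_sum => i _; nia.
rewrite -subr_ge0 /s /a mulr_sumr addrAC -sumrB.
have -> : (2 * #|P|%:Z : int) = \sum_(i | P i) 2 by rewrite sumr_const -[RHS]mulr_natr [#|P|%:R]natz.
rewrite -big_split /=; apply: sumr_ge0 => i _.
have [] : z i <= 1 \/ 2 <= z i by lia.
  by nia.
by nia.
Qed.

End SumsOfSquares.

Section MinimumInequality.
Local Open Scope ring_scope.

(** Here [a] and [s] are the sums of the squares and of the values of [k]
    integers.  The points near the minimum have coordinates [0] and [1] up to sign,
    in which case [a = s].  Otherwise the parity gap [a >= s + 2], the fact that
    no integer lies strictly between [1] and [2], or Cauchy-Schwarz gives a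
    strict inequality, according to the size of [a]. *)
Lemma minimum_inequality (h k a s t q : int) :
  2 <= h -> k <= 2 * h + 1 -> a = s + 2 * q -> `|s| <= a ->
  3 * `|s| <= a + 2 * k -> s ^+ 2 <= k * a -> (a != 0) || (s + 2 * t != 0) ->
  4 * h <= (2 * h + 2) * a + (2 * h - 1) * (s + 2 * t) ^+ 2 - s ^+ 2.
Proof.
wlog s0 : s t q / 0 <= s => [W|].
  have [s0|s0] := leP 0 s; first exact: W.
  move=> h2 kh aE sa sk CS nz.
  have := W (- s) (- t) (q + s); rewrite normrN sqrrN mulrN -opprD sqrrN oppr_eq0.
  apply => //; lia.
rewrite ger0_norm // => h2 kh aE sa sk CS nz.
set r := s + 2 * t in nz *.
have a0 : 0 <= a by lia.
have r2 : 0 <= (2 * h - 1) * r ^+ 2 by rewrite mulr_ge0 ?sqr_ge0 //; lia.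
have {}CS : s ^+ 2 <= (2 * h + 1) * a by apply: le_trans CS _; rewrite ler_wpM2r.
(* Cauchy-Schwarz already gives at least [a]. *)
have [large|] := leP (4 * h + 1) a; first by lia.
have [medium small|small _] := leP (2 * h + 4) a.
  (* The effective bound is [3 s <= a + 2 k]. *)
  have : 0 <= (a + 4 * h + 2 - 3 * s) * (a + 4 * h + 2 + 3 * s).
    by apply: mulr_ge0; lia.
  have : 0 <= (a - (2 * h + 4)) * (4 * h - a) by apply: mulr_ge0; lia.
  have : 0 <= (a - (2 * h + 4)) * h by apply: mulr_ge0; lia.
  lia.
have [q0|q0] : q = 0 \/ 1 <= q by lia.
  have {q q0 aE} aE : a = s by lia.
  subst a.
  (* By Cauchy-Schwarz [s <= 2 h + 1], and [s (2 h + 2 - s)] is concave; for odd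
     [s] its value [2 h + 1] at the ends is completed by [r ^ 2 >= 1]. *)
  have [s0'|sN0] := eqVneq s 0.
    have rE : r = 2 * t by rewrite /r s0' add0r.
    have : r != 0 by move: nz; rewrite s0' eqxx.
    rewrite rE s0' => t0; have : 1 <= t ^+ 2 by nia.
    move=> t2; have : 0 <= (t ^+ 2 - 1) * (2 * h - 1) by apply: mulr_ge0; lia.
    lia.
  have sk' : s <= 2 * h + 1.
    by rewrite -(ler_pM2r (_ : 0 < s)) //; lia.
  have [e|o] : (exists p, s = 2 * p) \/ (exists p, s = 2 * p + 1).
    have : s = 2 * (s %/ 2)%Z \/ s = 2 * (s %/ 2)%Z + 1 by lia.
    by case=> e; [left|right]; exists (s %/ 2)%Z.
  - case: e => p Ep.
    have : 0 <= (s - 2) * (2 * h - s) by apply: mulr_ge0; lia.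
    lia.
  - case: o => p Ep.
    have : 0 <= (s - 1) * (2 * h + 1 - s) by apply: mulr_ge0; lia.
    have : 0 <= (r ^+ 2 - 1) * (2 * h - 1).
      by apply: mulr_ge0; last lia; rewrite /r Ep; nia.
    lia.
(* Parity gap: [s <= a - 2]. *)
have : 0 <= (a - 2) * (2 * h + 3 - a) by apply: mulr_ge0; lia.
have : 0 <= (a - 2 - s) * (a - 2 + s) by apply: mulr_ge0; lia.
lia.
Qed.

End MinimumInequality.

(** * The form TF and the scaled form of D_n in adapted coordinates *)

Section AdaptedCoordinates.
Local Open Scope ring_scope.
Variables (S : comNzRingType) (k : nat).
Implicit Types x : 'cV[S]_k.+1.

(** With [t] the last coordinate of [x] and [z_i = x_i - t], these are
    [sum z_i ^ 2], [sum z_i] and [sum z_i + 2 t].  The nonzero vectors of the simplex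
    dual are, up to sign, those with [z] of type [(1,0,...,0)] or [(1,1,0,...,0)] and with
    [height_coord] in [{1,-1}], respectively equal to [0]; the vectors
    [(z, height_coord)] form the lattice D_n. *)
Definition shift_sqr x := \sum_i (x i 0 - x ord_max 0) ^+ 2.
Definition shift_sum x := \sum_i (x i 0 - x ord_max 0).
Definition height_coord x := shift_sum x + 2 * x ord_max 0.

Lemma shift_sqr_neq_max x :
  shift_sqr x = \sum_(i | i != ord_max) (x i 0 - x ord_max 0) ^+ 2.
Proof. by rewrite /shift_sqr (bigD1 ord_max) //= subrr expr0n add0r. Qed.

Lemma shift_sum_neq_max x :
  shift_sum x = \sum_(i | i != ord_max) (x i 0 - x ord_max 0).
Proof. by rewrite /shift_sum (bigD1 ord_max) //= subrr add0r. Qed.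

Lemma card_neq_max : #|[pred i : 'I_k.+1 | i != ord_max]| = k.
Proof. by have := cardC1 (@ord_max k); rewrite card_ord. Qed.

Lemma shift_sqrE x :
  shift_sqr x = \sum_i x i 0 ^+ 2 - 2 * x ord_max 0 * (\sum_i x i 0)
                + k.+1%:R * x ord_max 0 ^+ 2.
Proof.
rewrite /shift_sqr; under eq_bigr do rewrite sqrrB.
rewrite big_split sumrB /= sumrMnl -mulr_suml sumr_const card_ord.
rewrite -[_ *+ k.+1]mulr_natl; ring.
Qed.

Lemma shift_sumE x : shift_sum x = \sum_i x i 0 - k.+1%:R * x ord_max 0.
Proof. by rewrite /shift_sum sumrB sumr_const card_ord mulr_natl. Qed.

Lemma shift_sqrN x : shift_sqr (- x) = shift_sqr x.
Proof. by apply: eq_bigr => i _; rewrite !mxE -opprD sqrrN. Qed.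

Lemma shift_sumN x : shift_sum (- x) = - shift_sum x.
Proof. by rewrite /shift_sum -sumrN; apply: eq_bigr => i _; rewrite !mxE; ring. Qed.

Lemma height_coordN x : height_coord (- x) = - height_coord x.
Proof. by rewrite /height_coord shift_sumN mxE; ring. Qed.

End AdaptedCoordinates.

Section AdaptedInt.
Local Open Scope ring_scope.
Variables (R : realType) (k : nat).
Implicit Types v : 'cV[int]_k.+1.

Lemma shift_sqr_int v : shift_sqr (int_mx R v) = (shift_sqr v)%:~R.
Proof. by rewrite /shift_sqr rmorph_sum; apply: eq_bigr => i _; rewrite !mxE rmorphXn rmorphB. Qed.

Lemma shift_sum_int v : shift_sum (int_mx R v) = (shift_sum v)%:~R.
Proof. by rewrite /shift_sum rmorph_sum; apply: eq_bigr => i _; rewrite !mxE rmorphB. Qed.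

Lemma height_coord_int v : height_coord (int_mx R v) = (height_coord v)%:~R.
Proof. by rewrite /height_coord shift_sum_int mxE rmorphD rmorphM. Qed.

End AdaptedInt.

Section AdaptedOrder.
Local Open Scope ring_scope.
Variables (S : realDomainType) (k : nat).
Implicit Types x : 'cV[S]_k.+1.

Lemma shift_sqr_ge0 x : 0 <= shift_sqr x.
Proof. by apply: sumr_ge0 => i _; exact: sqr_ge0. Qed.

Lemma shift_CS x : shift_sum x ^+ 2 <= k%:R * shift_sqr x.
Proof.
rewrite shift_sum_neq_max shift_sqr_neq_max -[k in k%:R](@card_neq_max k).
exact: sqr_sum_le.
Qed.

Lemma adapted_eq0 x : shift_sqr x = 0 -> height_coord x = 0 -> x = 0.
Proof.
move=> /eqP; rewrite psumr_eq0 => [/allP z0|i _]; last exact: sqr_ge0.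
have {z0} xE i : x i 0 = x ord_max 0.
  by have := z0 i (mem_index_enum _); rewrite sqrf_eq0 subr_eq0 => /eqP.
have -> : height_coord x = 2 * x ord_max 0.
  by rewrite /height_coord /shift_sum big1 ?add0r // => i _; rewrite xE subrr.
move=> /eqP; rewrite mulf_eq0 pnatr_eq0 /= => /eqP t0.
by apply/colP => i; rewrite xE t0 mxE.
Qed.

End AdaptedOrder.

Section Forms.
Local Open Scope ring_scope.
Local Open Scope classical_set_scope.
Variables (R : realType) (k : nat).
Implicit Types (x : 'cV[R]_k.+1) (v : 'cV[int]_k.+1).
Let n := k.+1.

Lemma qform_bordered (a b c d : R) (A : 'M[R]_n) x :
  (forall i j, A i j = a * (i == j)%:R + b
     + c * ((i == ord_max)%:R + (j == ord_max)%:R)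
     + d * ((i == ord_max)%:R * (j == ord_max)%:R)) ->
  qform A x = a * \sum_i x i 0 ^+ 2 + b * (\sum_i x i 0) ^+ 2
    + 2 * c * x ord_max 0 * (\sum_i x i 0) + d * x ord_max 0 ^+ 2.
Proof.
move=> AE; rewrite qformE; move sE: (\sum_i x i 0) => s; move tE: (x ord_max 0) => t.
have pick (i : 'I_n) (F : 'I_n -> R) : \sum_j (i == j)%:R * F j = F i.
  rewrite (bigD1 i) //= eqxx mul1r big1 ?addr0 // => j.
  by rewrite eq_sym => /negPf ->; rewrite mul0r.
have row i : \sum_j A i j * (x i 0 * x j 0) =
    a * x i 0 ^+ 2 + (b + c * (ord_max == i)%:R) * s * x i 0
    + (c + d * (ord_max == i)%:R) * t * x i 0.
  transitivity (a * x i 0 * (\sum_j (i == j)%:R * x j 0)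
      + (b + c * (ord_max == i)%:R) * x i 0 * (\sum_j x j 0)
      + (c + d * (ord_max == i)%:R) * x i 0 * \sum_j (ord_max == j)%:R * x j 0).
    rewrite !mulr_sumr -!big_split /=; apply: eq_bigr => j _.
    by rewrite AE ![_ == ord_max]eq_sym; ring.
  by rewrite !pick sE tE; ring.
under eq_bigr do rewrite row.
transitivity (a * (\sum_i x i 0 ^+ 2) + (b * s + c * t) * (\sum_i x i 0)
   + (c * s + d * t) * (\sum_i (ord_max == i)%:R * x i 0)).
  rewrite !mulr_sumr -!big_split /=; apply: eq_bigr => j _; ring.
by rewrite !pick sE tE; ring.
Qed.

Let h := k./2.

Lemma qform_TF x : (0 < h)%N ->
  (4 * h%:R) * qform (TF R n) x = (2 * h%:R + 2) * shift_sqr x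
     + (2 * h%:R - 1) * height_coord x ^+ 2 - shift_sum x ^+ 2.
Proof.
move=> h0; have hR : (h%:R : R) != 0 by rewrite pnatr_eq0 -lt0n.
have max_eq (i : 'I_n) : (i.+1 == n) = (i == ord_max) by [].
pose b : R := 2^-1 - (2 * h%:R)^-1.
rewrite /height_coord shift_sqrE shift_sumE.
have := odd_double_half k; rewrite -/h -addnn; case: (boolP (odd k)) => /= odd_k kE.
  have nN : n = (2 * h + 2)%N by rewrite /n; lia.
  have nE : n%:R = 2 * h%:R + 2 :> R by rewrite nN natrD natrM.
  pose c : R := - ((n%:R ^+ 2 - 6 * n%:R + 10) / (2 * (n%:R - 2))) - b.
  pose d : R := n%:R ^+ 2 / 2 - 7 / 2 * n%:R + 7 - 1 - 2 * c.
  rewrite (@qform_bordered (1 - b) b c d) => [|i j].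
    rewrite /d /c /b nE.
    move: (h%:R) (\sum_i _) (\sum_i _) (x _ _) hR => H P Q t H0.
    by field; rewrite H0 addrK mulf_neq0 // pnatr_eq0.
  rewrite mxE /= odd_k /= !max_eq /d /c /b nE; move: (h%:R) hR => H H0.
  case: (i =P ord_max) => [->|/eqP iN]; case: (j =P ord_max) => [->|/eqP jN];
    rewrite ?eqxx ?(negPf iN) 1?eq_sym ?(negPf jN) /=; try by ring.
    by case: eqP => _ /=; first ring; field; rewrite H0 addrK mulf_neq0 // pnatr_eq0.
have nN : n = (2 * h + 1)%N by rewrite /n; lia.
have nE : n%:R = 2 * h%:R + 1 :> R by rewrite nN natrD natrM.
pose c : R := - ((n%:R ^+ 2 - 5 * n%:R + 8) / (2 * (n%:R - 1))) - b.
pose d : R := (n%:R ^+ 3 - 8 * n%:R ^+ 2 + 23 * n%:R - 20) / (2 * (n%:R - 1)) - 1 - 2 * c.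
rewrite (@qform_bordered (1 - b) b c d) => [|i j].
  rewrite /d /c /b nE.
  move: (h%:R) (\sum_i _) (\sum_i _) (x _ _) hR => H P Q t H0.
  by field; rewrite H0 addrK mulf_neq0 // pnatr_eq0.
rewrite mxE /= odd_k /= !max_eq /d /c /b nE; move: (h%:R) hR => H H0.
case: (i =P ord_max) => [->|/eqP iN]; case: (j =P ord_max) => [->|/eqP jN];
  rewrite ?eqxx ?(negPf iN) 1?eq_sym ?(negPf jN) /=; try by ring.
  by case: eqP => _ /=; first ring; field; rewrite H0 addrK mulf_neq0 // pnatr_eq0.
Qed.


Lemma TF_sym : (TF R n)^T = TF R n.
Proof. by apply/matrixP => i j; rewrite !mxE (eq_sym j i); case: (i.+1 == n); case: (j.+1 == n). Qed.

(** The matrix of the coordinates [(z, height_coord)], the last one being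
    [height_coord]. *)
Definition D_basis : 'M[R]_n :=
  \matrix_(i, j) (if i == ord_max then 1 + (2 - n%:R) * (j == ord_max)%:R
                  else (i == j)%:R - (j == ord_max)%:R).

Lemma D_basisE x i : (D_basis *m x) i 0 =
  if i == ord_max then height_coord x else x i 0 - x ord_max 0.
Proof.
have pick (i' : 'I_n) (F : 'I_n -> R) : \sum_j (j == i')%:R * F j = F i'.
  rewrite (bigD1 i') //= eqxx mul1r big1 ?addr0 // => j.
  by move=> /negPf ->; rewrite mul0r.
rewrite mxE; case: (i =P ord_max) => [->|/eqP iN].
  transitivity (\sum_j x j 0 + (2 - n%:R) * \sum_j (j == ord_max)%:R * x j 0).
    rewrite mulr_sumr -big_split /=; apply: eq_bigr => j _.
    by rewrite mxE eqxx; ring.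
  by rewrite pick /height_coord shift_sumE /n; ring.
rewrite -(pick i (fun j => x j 0)) -(pick ord_max (fun j => x j 0)) -sumrB.
by apply: eq_bigr => j _; rewrite mxE (negPf iN) [j == i]eq_sym; ring.
Qed.

(** Halving the norm of D_n gives the form the minimum 1. *)
Definition half_D : 'M[R]_n := 2^-1 *: (D_basis^T *m D_basis).

Lemma half_D_sym : half_D^T = half_D.
Proof. by rewrite linearZ /= trmx_mul trmxK. Qed.

Lemma qform_half_D x : 2 * qform half_D x = shift_sqr x + height_coord x ^+ 2.
Proof.
have -> : 2 * qform half_D x = ((D_basis *m x)^T *m (D_basis *m x)) 0 0.
  rewrite /qform -scalemxAr -scalemxAl mxE mulrA divff ?pnatr_eq0 // mul1r.
  by rewrite trmx_mul !mulmxA.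
rewrite mxE; under eq_bigr do rewrite mxE D_basisE -expr2.
rewrite (bigD1 ord_max) //= eqxx shift_sqr_neq_max addrC; congr (_ + _).
by apply: eq_bigr => i /negPf ->.
Qed.

Hypothesis k4 : (4 <= k)%N.

Lemma k_le_2h1 : (k <= h.*2.+1)%N. Proof. rewrite /h; lia. Qed.
Lemma h_ge2 : (2 <= h)%N. Proof. rewrite /h; lia. Qed.

Lemma TF_posdef : posdef (TF R n).
Proof.
split=> [|x x0]; first exact: TF_sym.
have h2 := h_ge2; have hR : 2 <= h%:R :> R by rewrite ler_nat.
rewrite -(pmulr_rgt0 _ (_ : 0 < 4 * h%:R)); last by lra.
rewrite qform_TF; last by rewrite (leq_trans _ h2).
have a0 := shift_sqr_ge0 x.
have CS : shift_sum x ^+ 2 <= (2 * h%:R + 1) * shift_sqr x.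
  apply: le_trans (shift_CS x) _; apply: ler_wpM2r => //.
  by rewrite -natrM natr1 ler_nat mul2n; exact: k_le_2h1.
have r0 := sqr_ge0 (height_coord x).
have [r00|rpos] := eqVneq (height_coord x ^+ 2) 0.
  have a_pos : 0 < shift_sqr x.
    rewrite lt_neqAle a0 andbT eq_sym; apply: contra_neq x0 => a00.
    by apply: adapted_eq0 => //; apply/eqP; rewrite -sqrf_eq0 r00.
  rewrite r00; lra.
have : 0 < (2 * h%:R - 1) * height_coord x ^+ 2.
  by apply: mulr_gt0; [lra|rewrite lt_neqAle eq_sym rpos].
lra.
Qed.

Lemma half_D_posdef : posdef half_D.
Proof.
split=> [|x x0]; first exact: half_D_sym.
rewrite -(pmulr_rgt0 _ (_ : 0 < 2)) // qform_half_D.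
rewrite lt_neqAle eq_sym addr_ge0 ?shift_sqr_ge0 ?sqr_ge0 // andbT.
rewrite paddr_eq0 ?shift_sqr_ge0 ?sqr_ge0 // sqrf_eq0; apply: contra x0.
by move=> /andP[/eqP a0 /eqP r0]; rewrite (adapted_eq0 a0 r0).
Qed.

(** The integer [4 h TF (v)]. *)
Definition TF_num v : int := (2 * h%:Z + 2) * shift_sqr v
  + (2 * h%:Z - 1) * height_coord v ^+ 2 - shift_sum v ^+ 2.

Lemma TF_numE v : 4 * h%:R * qform (TF R n) (int_mx R v) = (TF_num v)%:~R.
Proof.
rewrite qform_TF; last by rewrite (leq_trans _ h_ge2).
rewrite shift_sqr_int height_coord_int shift_sum_int /TF_num.
by rewrite !(rmorphB, rmorphD, rmorphM, rmorphXn).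
Qed.

Lemma half_D_intE v :
  2 * qform half_D (int_mx R v) = (shift_sqr v + height_coord v ^+ 2)%:~R.
Proof. by rewrite qform_half_D shift_sqr_int height_coord_int [RHS]rmorphD /= rmorphXn. Qed.

Lemma TF_eq1 v : qform (TF R n) (int_mx R v) = 1 <-> TF_num v = 4 * h%:Z.
Proof.
have hR : (4 * h%:R : R) != 0.
  by rewrite mulf_neq0 // pnatr_eq0 // -lt0n (leq_trans _ h_ge2).
have hE : 4 * h%:R = (4 * h%:Z)%:~R :> R by rewrite rmorphM.
split=> [q1|num]; first by apply/eqP; rewrite -(eqr_int R) -TF_numE q1 mulr1 hE.
by apply: (mulfI hR); rewrite TF_numE num mulr1 hE.
Qed.

Lemma half_D_eq1 v :
  qform half_D (int_mx R v) = 1 <-> shift_sqr v + height_coord v ^+ 2 = 2.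
Proof.
have R2 : (2 : R) != 0 by rewrite pnatr_eq0.
split=> [q1|num]; first by apply/eqP; rewrite -(eqr_int R) -half_D_intE q1 mulr1.
by apply: (mulfI R2); rewrite half_D_intE num mulr1.
Qed.

Lemma shift_parity v : exists q, shift_sqr v = shift_sum v + 2 * q.
Proof. exact: sum_sqr_parity. Qed.

Lemma adapted_neq0 v : v != 0 -> (shift_sqr v != 0) || (height_coord v != 0).
Proof.
apply: contra_neqT; rewrite negb_or !negbK => /andP[/eqP a0 /eqP r0].
exact: adapted_eq0.
Qed.

Lemma TF_num_min v : v != 0 -> 4 * h%:Z <= TF_num v.
Proof.
move=> /adapted_neq0 nz; have [q aE] := shift_parity v.
have bounds (w : 'cV[int]_k.+1) : shift_sum w <= shift_sqr w /\ 3 * shift_sum w <= shift_sqr w + 2 * k%:Z.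
  rewrite shift_sum_neq_max shift_sqr_neq_max.
  have := sum_sqr_bounds [pred i | i != ord_max] (fun i => w i 0 - w ord_max 0).
  by rewrite card_neq_max.
have [b1 b2] := bounds v; have := bounds (- v).
rewrite shift_sumN shift_sqrN => -[b3 b4].
apply: (minimum_inequality (k := k%:Z) _ _ aE) => //.
- exact: h_ge2.
- by have := k_le_2h1; lia.
- lia.
- lia.
- by have := shift_CS v; rewrite natz.
Qed.

Lemma half_D_num_min v : v != 0 -> 2 <= shift_sqr v + height_coord v ^+ 2.
Proof.
move=> /adapted_neq0; have [q] := shift_parity v; rewrite /height_coord.
have := shift_sqr_ge0 v; move: (shift_sqr v) (shift_sum v) (v ord_max 0) => a s t.
move=> a0 aE nz; have r0 := sqr_ge0 (s + 2 * t).
have [p [e|o]] : exists p, s = 2 * p \/ s = 2 * p + 1.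
- exists (s %/ 2)%Z; lia.
- have : (s + 2 * t) ^+ 2 = 4 * (p + t) ^+ 2 by rewrite e; ring.
  have [r00|] := eqVneq (s + 2 * t) 0; first by move: nz; rewrite r00 eqxx; lia.
  by nia.
have : (s + 2 * t) ^+ 2 = 4 * (p + t) ^+ 2 + 4 * (p + t) + 1 by rewrite o; ring.
nia.
Qed.

Lemma common_minimal_coordinates v : TF_num v = 4 * h%:Z ->
  shift_sqr v + height_coord v ^+ 2 = 2 ->
  `|shift_sum v| = shift_sqr v /\
   (shift_sqr v = 2 /\ height_coord v = 0 \/ shift_sqr v = 1 /\ `|height_coord v| = 1).
Proof.
rewrite /TF_num; move: (shift_sqr_ge0 v).
move: (shift_sqr v) (shift_sum v) (height_coord v) => a s r a0 TFe De.
have [r0|[r1|r2]] : r = 0 \/ `|r| = 1 \/ 2 <= `|r| by lia.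
- have a2 : a = 2 by move: De; rewrite r0; lia.
  split; last by left.
  have : s ^+ 2 = 4 by move: TFe; rewrite r0 a2; lia.
  by rewrite a2; nia.
- have rr : r ^+ 2 = 1 by nia.
  have a1 : a = 1 by lia.
  split; last by right.
  have : s ^+ 2 = 1 by move: TFe; rewrite rr a1; lia.
  by rewrite a1; nia.
- nia.
Qed.

End Forms.

(** * The common wall *)

Section TheWall.
Local Open Scope ring_scope.
Local Open Scope classical_set_scope.
Variables (R : realType) (k : nat).
Implicit Types v : 'cV[int]_k.+1.
Let n := k.+1.
Let h := k./2.
Hypothesis k4 : (4 <= k)%N.

(** All vectors in question have [z] equal, up to sign, to an indicator function. *)
Lemma shift_indicator v (Z : {set 'I_n}) (t e : int) :
  ord_max \notin Z -> e ^+ 2 = 1 -> (forall i, v i 0 = t + e * (i \in Z)%:Z) ->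
  [/\ v ord_max 0 = t, shift_sqr v = #|Z|%:Z & shift_sum v = e * #|Z|%:Z].
Proof.
move=> Zmax e2 vE.
have tE : v ord_max 0 = t by rewrite vE (negPf Zmax) mulr0 addr0.
have cardE : #|Z|%:Z = \sum_i (i \in Z)%:Z.
  by rewrite -sum1_card big_mkcond (big_morph Posz PoszD (erefl 0%:Z)); apply: eq_bigr => i _; case: (i \in Z).
split=> //.
  rewrite cardE; apply: eq_bigr => i _; rewrite tE vE addrC addKr exprMn e2 mul1r.
  by case: (i \in Z).
by rewrite cardE mulr_sumr; apply: eq_bigr => i _; rewrite tE vE addrC addKr.
Qed.

Lemma simplex_dual_cases v : simplex_dual n v ->
  v = 0 \/ exists (Z : {set 'I_n}) (t e : int),
    [/\ ord_max \notin Z, forall i, v i 0 = t + e * (i \in Z)%:Z &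
        [\/ [/\ #|Z| = 1%N, t = 0 & e = 1], [/\ #|Z| = 1%N, t = 1 & e = -1] |
            [/\ #|Z| = 2%N, t = 1 & e = -1]]].
Proof.
case=> [->|[i ltin ->]|[Z [Zmax cardZ ->]]]; [by left|right..].
  exists [set i]%SET, 0, 1; split=> [|j|].
  - by rewrite inE; apply: contraTN ltin => /eqP <-; rewrite ltnn.
  - by rewrite mxE inE eqxx andbT mul1r add0r; case: (j == i).
  - by constructor 1; rewrite cards1.
exists Z, 1, (-1); split=> [|j|].
- by apply/negP => /Zmax; rewrite ltnn.
- by rewrite mxE; case: (j \in Z).
- by case: cardZ; [constructor 2|constructor 3].
Qed.

Lemma simplex_dual_min v : simplex_dual n v ->
  v = 0 \/ TF_num v = 4 * h%:Z /\ shift_sqr v + height_coord v ^+ 2 = 2.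
Proof.
move=> /simplex_dual_cases[->|[Z [t [e [Zmax vE]]]]]; first by left.
rewrite /TF_num /height_coord -/h => cases; right.
have e2 : e ^+ 2 = 1 by case: cases => -[_ _ ->].
have [-> -> ->] := shift_indicator Zmax e2 vE.
by case: cases => -[-> -> ->]; split; ring.
Qed.

(** Up to sign [sum z_i <= 0].  Then [sum (z_i ^ 2 + z_i) = 0], so that all [z_i] are
    [0] or [-1]. *)
Lemma min_simplex_dual v : TF_num v = 4 * h%:Z ->
  shift_sqr v + height_coord v ^+ 2 = 2 -> simplex_dual n v \/ simplex_dual n (- v).
Proof.
wlog s0 : v / shift_sum v <= 0 => [W|] TFv Dv.
  have [|s0] := leP (shift_sum v) 0; first by move=> /W; apply.
  have := W (- v); rewrite shift_sumN oppr_le0 opprK ltW // => /(_ isT).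
  by rewrite /TF_num shift_sqrN shift_sumN height_coordN !sqrrN => /(_ TFv Dv)[]; [right|left].
have [] := common_minimal_coordinates k4 TFv Dv; rewrite ler0_norm // => sa cases.
have z01 i : v i 0 = v ord_max 0 \/ v i 0 = v ord_max 0 - 1.
  have : \sum_i ((v i 0 - v ord_max 0) ^+ 2 + (v i 0 - v ord_max 0)) = 0.
    by rewrite big_split /= -/(shift_sqr v) -/(shift_sum v) -sa addNr.
  move=> /eqP; rewrite psumr_eq0 => [/allP /(_ i (mem_index_enum _)) /= /eqP|j _].
    by move: (v i 0) (v ord_max 0) => a b; nia.
  by move: (v j 0) (v ord_max 0) => a b; nia.
have [t tE] : exists t : int, v ord_max 0 = t by exists (v ord_max 0).
rewrite tE in z01.
pose Z := [set i | v i 0 != t]%SET.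
have Zmax : ord_max \notin Z by rewrite inE tE eqxx.
have vE i : v i 0 = t + (- 1) * (i \in Z)%:Z.
  by rewrite inE; case: eqVneq => [->|]; [rewrite mulr0 addr0|case: (z01 i) => -> //; rewrite eqxx].
have ltZ i : i \in Z -> (i.+1 < n)%N.
  move=> iZ; rewrite ltn_neqAle ltn_ord andbT; apply: contra Zmax => /eqP iE.
  by rewrite (_ : ord_max = i) //; apply: val_inj; case: iE.
have [p pE] : exists p, #|Z| = p by exists #|Z|.
have [_ aE sE] := shift_indicator Zmax (erefl : (-1) ^+ 2 = 1 :> int) vE.
have {}aE : shift_sqr v = p%:Z by rewrite -pE.
have {}sE : shift_sum v = - 1 * p%:Z by rewrite -pE.
have vT : t = 1 -> p = 1%N \/ p = 2%N -> simplex_dual n v.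
  move=> t1 p12; constructor 3; exists Z; split=> //; first by rewrite pE.
  by apply/colP => i; rewrite vE t1 mxE; case: (i \in Z).
move: cases; rewrite /height_coord sE tE aE => -[[a2 r0]|[a1 r1]].
  by left; apply: vT; [lia|right; lia].
have p1 : p = 1%N by lia.
have [t1|t0] : t = 1 \/ t = 0 by lia.
  by left; apply: vT => //; left.
right; have /cards1P[i Zi] : #|Z| == 1%N by rewrite pE p1.
constructor 2; exists i; first by apply: ltZ; rewrite Zi inE.
apply/colP => j; rewrite mxE vE t0 Zi inE mxE eqxx andbT.
by case: (j == i).
Qed.

(** The vector with last coordinate [h] and all other [z_i] equal to [-1]. *)
Definition TF_only_vector : 'cV[int]_n :=
  \col_i (h%:Z - (i != ord_max)%:Z).

Lemma TF_only_vectorP :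
  TF_num TF_only_vector = 4 * h%:Z /\
  shift_sqr TF_only_vector + height_coord TF_only_vector ^+ 2 != 2.
Proof.
pose Z := [set i : 'I_n | i != ord_max]%SET.
have Zmax : ord_max \notin Z by rewrite inE eqxx.
have cardZ : #|Z| = k by rewrite cardsE card_neq_max.
have [] := @shift_indicator TF_only_vector Z h%:Z (-1) Zmax erefl.
  by move=> i; rewrite mxE inE mulN1r.
rewrite /TF_num /height_coord -/h cardZ => -> -> ->.
have [e|e] : k = (2 * h)%N \/ k = (2 * h + 1)%N by rewrite /h; lia.
  by rewrite e PoszM; split; [ring|nia].
by rewrite e PoszD PoszM; split; [ring|nia].
Qed.

Definition D_only_vector (i j : 'I_n) : 'cV[int]_n := delta_mx i 0 - delta_mx j 0.

Lemma D_only_vectorP (i j : 'I_n) : i != ord_max -> j != ord_max -> i != j ->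
  TF_num (D_only_vector i j) != 4 * h%:Z /\
  shift_sqr (D_only_vector i j) + height_coord (D_only_vector i j) ^+ 2 = 2.
Proof.
move=> iN jN ij.
have t0 : D_only_vector i j ord_max 0 = 0.
  by rewrite !mxE eqxx !andbT ![ord_max == _]eq_sym (negPf iN) (negPf jN).
have pick (i' : 'I_n) : \sum_l (l == i')%:R = 1 :> int.
  by rewrite (bigD1 i') //= eqxx big1 ?addr0 // => l /negPf ->.
have s0 : shift_sum (D_only_vector i j) = 0.
  rewrite /shift_sum t0; under eq_bigr do rewrite !mxE eqxx !andbT subr0.
  by rewrite sumrB !pick subrr.
have a2 : shift_sqr (D_only_vector i j) = 2.
  rewrite /shift_sqr t0.
  transitivity (\sum_l (l == i)%:R + \sum_l (l == j)%:R : int); last by rewrite !pick.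
  rewrite -big_split; apply: eq_bigr => l _; rewrite !mxE eqxx !andbT subr0.
  by have [->|_] := eqVneq l i; [rewrite (negPf ij)|case: (l == j)].
rewrite /TF_num /height_coord s0 a2 t0 -/h; split; last by ring.
by apply/eqP; lia.
Qed.

(** Polarizing the conditions at [1 - e_i - e_j], where [1] is the all ones
    vector, gives [E_ij = (E 1)_j] for [i <> j]; hence all these entries
    have one common value, which vanishes by the condition at [e_i - e_j]. *)
Lemma TW_rigid (i0 j0 : 'I_n) (E : 'M[R]_n) :
  i0 != ord_max -> j0 != ord_max -> i0 != j0 -> E^T = E ->
  (forall u, simplex_dual n u -> qform E (int_mx R u) = 0) ->
  qform E (int_mx R (D_only_vector i0 j0)) = 0 -> E = 0.
Proof.
move=> i0N j0N ij0 symE ET Ew.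
pose e (i : 'I_n) : 'cV[R]_n := delta_mx i 0.
pose one : 'cV[R]_n := const_mx 1.
have intE i : int_mx R (delta_mx i 0) = e i by exact: map_delta_mx.
have polar i x : ((e i)^T *m E *m x) 0 0 = \sum_j E i j * x j 0.
  by rewrite /e trmx_delta -rowE mxE; apply: eq_bigr => j _; rewrite mxE.
have ltn_of (i : 'I_n) : i != ord_max -> (i.+1 < n)%N.
  by have := ltn_ord i; rewrite -val_eqE /n /=; lia.
have polar_e i j : ((e i)^T *m E *m e j) 0 0 = E i j.
  by rewrite polar (bigD1 j) //= mxE !eqxx mulr1 big1 ?addr0 // => l /negPf lj; rewrite mxE lj mulr0.
have Eii i : i != ord_max -> E i i = 0.
  move=> iN; rewrite -polar_e -/(qform E (e i)) -intE; apply: ET.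
  by constructor 2; exists i => //; exact: ltn_of.
pose c i := ((e i)^T *m E *m one) 0 0.
have q1 i : i != ord_max -> qform E (one - e i) = 0.
  move=> iN; rewrite (_ : one - e i = int_mx R (\col_j (j \notin [set i]%SET)%:Z)).
    apply: ET; constructor 3; exists [set i]%SET; split=> //.
      by move=> j; rewrite inE => /eqP ->; exact: ltn_of.
    by left; rewrite cards1.
  by apply/colP => j; rewrite !mxE inE eqxx andbT; case: (j == i); rewrite ?subrr ?subr0.
have cE i : i != ord_max -> qform E one = 2 * c i.
  move=> iN; have := q1 i iN; rewrite qformB // -/(c i) /(qform E (e i)) polar_e Eii //.
  by rewrite addr0 => /subr0_eq.
have Eij i j : i != ord_max -> j != ord_max -> i != j -> E i j = c i.
  move=> iN jN ij.
  have : qform E (one - e j - e i) = 0.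
    rewrite (_ : _ - e i = int_mx R (\col_l (l \notin [set i; j]%SET)%:Z)).
      apply: ET; constructor 3; exists [set i; j]%SET; split=> //.
        by move=> l; rewrite !inE => /orP[] /eqP ->; exact: ltn_of.
      by right; rewrite cards2 ij.
    apply/colP => l; rewrite !mxE !inE eqxx !andbT.
    have [->|_] := eqVneq l i; first by rewrite (negPf ij) subr0 subrr.
    by case: (l == j); rewrite ?subr0 ?subrr.
  rewrite qformB // q1 // /(qform E (e i)) polar_e Eii // mulmxBr addr0 sub0r.
  have entryB (M N : 'M[R]_1) : (M - N) 0 0 = M 0 0 - N 0 0 by rewrite !mxE.
  rewrite entryB polar_e -/(c i) => /eqP.
  by rewrite oppr_eq0 mulf_eq0 pnatr_eq0 /= subr_eq0 => /eqP ->.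
have c0 : c i0 = 0.
  have : int_mx R (D_only_vector i0 j0) = e i0 - e j0.
    by rewrite -!intE /int_mx map_mxB.
  move=> DE; move: Ew; rewrite DE qformB // /qform !polar_e !Eii //.
  have -> : E j0 i0 = E i0 j0 by rewrite -[in LHS]symE mxE.
  rewrite Eij // addr0 sub0r => /eqP.
  by rewrite oppr_eq0 mulf_eq0 pnatr_eq0 /= => /eqP.
have q0 : qform E one = 0 by rewrite (cE i0) // c0 mulr0.
have {}c0 i : i != ord_max -> c i = 0.
  move=> iN; have := cE i iN; rewrite q0 => /esym/eqP.
  by rewrite mulf_eq0 pnatr_eq0 /= => /eqP.
have {}Eij i j : i != ord_max -> j != ord_max -> E i j = 0.
  move=> iN jN; have [<-|ij] := eqVneq i j; first exact: Eii.
  by rewrite Eij // c0.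
have csum i : c i = \sum_j E i j.
  by rewrite /c polar; apply: eq_bigr => j _; rewrite mxE mulr1.
have Eimax i : i != ord_max -> E i ord_max = 0.
  move=> iN; have := c0 i iN; rewrite csum (bigD1 ord_max) //= big1 ?addr0 //.
  by move=> j; exact: Eij.
have Emaxi i : i != ord_max -> E ord_max i = 0 by move=> iN; rewrite -symE mxE Eimax.
have Emax : E ord_max ord_max = 0.
  have : c ord_max = 0.
    have := q0; rewrite qformE (bigD1 ord_max) //= [X in _ + X]big1 => [|i iN].
      rewrite addr0 csum => q; rewrite -[RHS]q; apply: eq_bigr => j _.
      by rewrite !mxE !mulr1.
    apply: etrans (c0 i iN); rewrite csum; apply: eq_bigr => j _.
    by rewrite !mxE !mulr1.
  by rewrite csum (bigD1 ord_max) //= big1 ?addr0.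
apply/matrixP => i j; rewrite [RHS]mxE.
have [->|iN] := eqVneq i ord_max; have [->|jN] := eqVneq j ord_max => //.
- exact: Emaxi.
- exact: Eimax.
- exact: Eij.
Qed.

Lemma TF_arith_min : arith_min (TF R n) 1.
Proof.
have h0 : 0 < 4 * h%:R :> R by rewrite mulr_gt0 // ltr0n (leq_trans _ (h_ge2 k4)).
split=> [|v v0].
  have [num1 _] := TF_only_vectorP; exists TF_only_vector; last exact/(TF_eq1 R k4).
  apply: contraPneq num1 => ->; rewrite /TF_num /height_coord !shift_sqrE !shift_sumE !mxE.
  by rewrite !big1 => [|i _|i _]; rewrite ?mxE //; have := h_ge2 k4; rewrite -/h; lia.
rewrite -(ler_pM2l h0) mulr1 TF_numE // (_ : _ * h%:R = (4 * h%:Z)%:~R); last by rewrite rmorphM.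
by rewrite ler_int; exact: TF_num_min.
Qed.

Lemma two_border_indices : exists i j : 'I_n, [/\ i != ord_max, j != ord_max & i != j].
Proof.
have [lt0 lt1] : (0 < n /\ 1 < n)%N by rewrite /n; lia.
by exists (Ordinal lt0), (Ordinal lt1); split; rewrite -val_eqE /=; lia.
Qed.

Lemma half_D_arith_min : arith_min (half_D R k) 1.
Proof.
split=> [|v v0].
  have [i [j [iN jN ij]]] := two_border_indices.
  have [_ num2] := D_only_vectorP iN jN ij.
  exists (D_only_vector i j); last exact/half_D_eq1.
  apply: contraPneq num2 => ->; rewrite /height_coord !shift_sqrE !shift_sumE !mxE.
  by rewrite !big1 => [|l _|l _]; rewrite ?mxE //; lia.
rewrite -(ler_pM2l (_ : 0 < 2)) // mulr1 half_D_intE (_ : 2 = 2%:~R) // ler_int.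
exact: half_D_num_min.
Qed.

Lemma TW_common_wall :
  [/\ perfect (TF R n), perfect (half_D R k) &
      common_wall (n * n.+1)./2 (perfect_domain (half_D R k))
        (perfect_domain (TF R n)) (TW R n)].
Proof.
have [i [j [iN jN ij]]] := two_border_indices.
have TFE v := min_vectorsE v TF_arith_min.
have DE v := min_vectorsE v half_D_arith_min.
have [TFv nDv] := TF_only_vectorP; have [nTFw Dw] := D_only_vectorP iN jN ij.
apply: (common_wall_of_pencil (v := TF_only_vector) (w := D_only_vector i j)
  _ _ TF_arith_min half_D_arith_min).
- exact: TF_posdef.
- exact: half_D_posdef.
- move=> v /simplex_dual_min[->|[TFe De]]; [by left|right].
  by rewrite TFE DE; split; [exact/TF_eq1|exact/half_D_eq1].
- by move=> v; rewrite TFE DE => /(TF_eq1 R k4) TFe /half_D_eq1; exact: min_simplex_dual.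
- by rewrite TFE; exact/TF_eq1.
- by rewrite DE => /half_D_eq1; exact/eqP.
- by rewrite DE; exact/half_D_eq1.
- by rewrite TFE => /(TF_eq1 R k4); exact/eqP.
- by move=> E symE; exact: TW_rigid.
Qed.

(** The basis realizes the coordinates [(z, height_coord)]: the parity condition
    of D_n expresses that [height_coord] and [sum z_i] differ by an even number. *)
Lemma D_basis_gram :
  gram_form (@D_lattice R n) ((D_basis R k)^T *m D_basis R k).
Proof.
set B := D_basis R k; exists B; split=> //.
  apply/mxrank_unit; have := posdef_unit (@half_D_posdef R k).
  by rewrite /half_D unitmxZ ?unitfE ?invr_eq0 ?pnatr_eq0 // unitmx_mul => /andP[].
have sumE (y : 'I_n -> R) : \sum_i y i = y ord_max + \sum_(i | i != ord_max) y i.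
  by rewrite (bigD1 ord_max).
apply/seteqP; split=> [x [xint [z zE]]|_ [v _ <-]].
  have [f fE] : exists f : 'I_n -> int, forall i, x i 0 = (f i)%:~R.
    by exists (fun i => Num.floor (x i 0)) => i; rewrite floorK.
  have zE' : \sum_i f i = 2 * z.
    apply/eqP; rewrite -(eqr_int R) -zE rmorph_sum; apply/eqP.
    by apply: eq_bigr => i _; rewrite fE.
  pose t := f ord_max - z.
  pose v : 'cV[int]_n := \col_i (t + (if i == ord_max then 0 else f i)).
  have vt : v ord_max 0 = t by rewrite mxE eqxx addr0.
  exists v => //; apply/colP => i; rewrite D_basisE.
  case: eqP => [->|/eqP iN]; last by rewrite !mxE eqxx (negPf iN) addr0 -rmorphB fE addrC addKr.
  rewrite height_coord_int fE; congr (_%:~R).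
  rewrite /height_coord shift_sum_neq_max vt.
  rewrite (eq_bigr f) => [|j jN]; last by rewrite mxE (negPf jN) addrC addKr.
  move: zE'; rewrite (bigD1 ord_max) //= /t.
  by move: (\sum_(i | _) f i) (f ord_max) => a b; lia.
split=> [i|].
  rewrite D_basisE; case: eqP => _; first by rewrite height_coord_int intr_int.
  by rewrite !mxE -rmorphB intr_int.
exists (shift_sum v + v ord_max 0).
under eq_bigr do rewrite D_basisE.
rewrite (bigD1 ord_max) //= eqxx (eq_bigr (fun i => int_mx R v i 0 - int_mx R v ord_max 0)).
  rewrite -shift_sum_neq_max height_coord_int shift_sum_int -rmorphD; congr (_%:~R).
  by rewrite /height_coord; ring.
by move=> i /negPf ->.
Qed.

Lemma half_D_domain : domain_of_type_D (perfect_domain (half_D R k)).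
Proof.
have [_ perfD _] := TW_common_wall.
exists ((D_basis R k)^T *m D_basis R k), (half_D R k); split=> //.
  exact: D_basis_gram.
exists 2^-1, 1%:M; split; [by rewrite invr_gt0|exact: unitmx1|].
by rewrite /int_mx map_mx1 trmx1 mul1mx mulmx1.
Qed.

End TheWall.

(** * Lattices with an explicit basis *)

Section LatticeBases.
Local Open Scope ring_scope.
Local Open Scope classical_set_scope.
Variables (R : realType) (k n : nat).
Implicit Types (L : set 'cV[R]_k) (B D : 'M[R]_(k, n)).

Definition lattice_of B : set 'cV[R]_k := [set B *m int_mx R z | z in [set: 'cV[int]_n]].

Lemma gram_form_lattice_of B : posdef (B^T *m B) -> gram_form (lattice_of B) (B^T *m B).
Proof.
move=> /posdef_unit/mxrank_unit rk; exists B; split=> //.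
apply/eqP; rewrite eqn_leq rank_leq_col /= -[X in (X <= _)%N]rk.
exact: mxrankM_maxr.
Qed.

(** It suffices that a multiple of the lattice of [B] lies in [L]. *)
Lemma linear_hull_lattice L B (c : R) :
  c != 0 -> (forall x, L x -> exists u, x = B *m u) ->
  (forall z, L (c *: (B *m int_mx R z))) -> linear_hull L (limg (linfun (mulmx B : 'cV[R]_n -> _))).
Proof.
move=> c0 LB BL; split=> [x /LB[u ->]|W' LW'].
  by have := memv_img (linfun (mulmx B : 'cV[R]_n -> _)) (memvf u); rewrite lfunE.
apply/subvP => _ /memv_imgP[u _ ->]; rewrite lfunE /=.
rewrite [u]matrix_sum_delta mulmx_sumr; apply: memv_suml => j _.
rewrite mulmx_sumr; apply: memv_suml => l _; rewrite -scalemxAr; apply: memvZ.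
rewrite -[_ *m _](scalerK c0); apply/memvZ/LW'.
by have := BL (delta_mx j l); rewrite /int_mx map_delta_mx.
Qed.

(** A vector of the hull of [L] has the scalar products with the columns of [D] as
    its coordinates in the basis [B]. *)
Lemma dual_lattice_basis L B D :
  linear_hull L (limg (linfun (mulmx B : 'cV[R]_n -> _))) -> D^T *m B = 1%:M ->
  (forall j, L (col j D)) ->
  (forall x j, L x -> (B^T *m x) j 0 \is a Num.int) ->
  dual_lattice L = lattice_of B.
Proof.
move=> hullL DB LD BL; apply/seteqP; split=> [y [[W hullW yW] yL]|_ [z _ <-]].
  rewrite (linear_hull_uniq hullW hullL) in yW.
  have /memv_imgP[u _] := yW; rewrite lfunE /= => yE.
  have uE j : u j 0 = (y^T *m col j D) 0 0.
    rewrite -[u]mul1mx -DB -mulmxA -yE !mxE; apply: eq_bigr => i _.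
    by rewrite !mxE mulrC.
  exists (\col_j Num.floor (u j 0)) => //; rewrite yE; congr (_ *m _).
  by apply/colP => j; rewrite !mxE floorK // uE; exact/yL/LD.
split; first by exists (limg (linfun (mulmx B : 'cV[R]_n -> _))) => //;
  have := memv_img (linfun (mulmx B : 'cV[R]_n -> _)) (memvf (int_mx R z)); rewrite lfunE.
move=> x Lx; rewrite trmx_mul -mulmxA mxE; apply: rpred_sum => j _.
by apply: rpredM; [rewrite !mxE intr_int|exact: BL].
Qed.

End LatticeBases.

Section NumericalVectors.
Local Open Scope ring_scope.

Lemma sum_iota (V : nmodType) n (f : nat -> V) :
  \sum_(i < n) f i = foldr (fun i a => f i + a) 0 (iota 0 n).
Proof. by rewrite -(big_mkord xpredT) unlock /reducebig /index_iota subn0. Qed.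

(** With indices in [nat], sums over [iota] simplify to explicit expressions. *)
Lemma col_nat (V : Type) n (x : 'cV[V]_n.+1) : exists f : nat -> V, forall i, x i 0 = f i.
Proof. by exists (fun i => x (inord i) 0) => i; rewrite inord_val. Qed.

Lemma mulmx_iota (V : pzRingType) m n (B : 'M[V]_(m, n)) (x : 'cV[V]_n) (b : nat -> nat -> V) (f : nat -> V) i :
  (forall i j, B i j = b i j) -> (forall j, x j 0 = f j) ->
  (B *m x) i 0 = foldr (fun j a => b i j * f j + a) 0 (iota 0 n).
Proof.
move=> BE xE; rewrite mxE -(sum_iota n (fun j => b i j * f j)).
by apply: eq_bigr => j _; rewrite BE xE.
Qed.

End NumericalVectors.

(** * Coxeter's lattice *)

Section Coxeter.
Local Open Scope ring_scope.
Local Open Scope classical_set_scope.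
Variable R : realType.

(** The columns [c - e_0 - e_j], [1 <= j <= 4], and [2 e_0 - c], where [c] has all
    coordinates equal to [1/3]; the first four are minimal vectors. *)
Definition phi_entry (i j : nat) : R :=
  if j == 4%N then (2 *+ (i == 0%N)) - 3^-1 else 3^-1 - (i == 0%N)%:R - (i == j.+1)%:R.

Definition phi_basis : 'M[R]_(6, 5) := \matrix_(i, j) phi_entry i j.

Lemma phi_gram : phi_basis^T *m phi_basis = (4 / 3) *: TF R 5.
Proof.
apply/matrixP => i j; rewrite mxE.
under eq_bigr do rewrite !mxE.
rewrite (sum_iota 6 (fun l => phi_entry l i * phi_entry l j)) !mxE.
case: i j => [[|[|[|[|[|i]]]]] //= lti] [[|[|[|[|[|j]]]]] //= ltj].
all: by rewrite /phi_entry /=; field.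
Qed.

(** The coordinates of a lattice vector are [phi_frac / 3 + phi_int i], so that
    [phi_frac] modulo [3] is their common class modulo [1]. *)
Definition phi_frac (S : pzRingType) (f : nat -> S) : S :=
  f 0%N + f 1%N + f 2%N + f 3%N - f 4%N.

Definition phi_int (S : pzRingType) (f : nat -> S) (i : nat) : S :=
  if i == 0%N then 2 * f 4%N - f 0%N - f 1%N - f 2%N - f 3%N
  else if (i < 5)%N then - f i.-1 else 0.

Lemma phi_basisE (x : 'cV[R]_5) (f : nat -> R) (i : 'I_6) : (forall j, x j 0 = f j) ->
  (phi_basis *m x) i 0 = phi_frac f / 3 + phi_int f i.
Proof.
move=> xE; rewrite (@mulmx_iota _ _ _ _ _ phi_entry f) // => [|l j]; last by rewrite mxE.
rewrite /phi_frac /phi_int /phi_entry.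
by case: i => [[|[|[|[|[|[|i]]]]]] //= lti]; field.
Qed.

Lemma phi_basis_int (z : 'cV[int]_5) (f : nat -> int) (i : 'I_6) : (forall j, z j 0 = f j) ->
  (phi_basis *m int_mx R z) i 0 = (phi_frac f)%:~R / 3 + (phi_int f i)%:~R.
Proof.
move=> zE; rewrite (@phi_basisE _ (fun j => (f j)%:~R)) => [|j]; last by rewrite mxE zE.
congr (_ / _ + _); first by rewrite /phi_frac !(rmorphB, rmorphD).
rewrite /phi_int; case: ifP => _; first by rewrite !(rmorphB, rmorphM).
by case: ifP => _; rewrite ?rmorphN.
Qed.

Lemma phi_basis_sum (x : 'cV[R]_5) : \sum_i (phi_basis *m x) i 0 = 0.
Proof.
have [f xE] := col_nat x.
under eq_bigr do rewrite (phi_basisE _ xE).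
rewrite (sum_iota 6 (fun i => phi_frac f / 3 + phi_int f i)) /= /phi_frac /phi_int /=.
by field.
Qed.

(** The differences with the last coordinate give the coefficients of the first
    four basis vectors, the last coordinate gives that of the fifth, and the
    coordinate 0 is then right because of the sum. *)
Lemma A5_coordinates (S : comNzRingType) (g : nat -> S) : foldr (fun i a => g i + a) 0 (iota 0 6) = 0 ->
  exists f : nat -> S, phi_frac f = 3 * g 5%N /\
    forall i, (i < 6)%N -> phi_int f i = g i - g 5%N.
Proof.
move=> /= sum0; pose f j := if (j < 4)%N then g 5%N - g j.+1
  else g 5%N - g 1%N - g 2%N - g 3%N - g 4%N.
exists f; rewrite /phi_frac /f /=; split; first by ring.
move=> [|[|[|[|[|[|i]]]]]] //= _; rewrite /phi_int /=; try by ring.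
have -> : g 0%N = - (g 1%N + g 2%N + g 3%N + g 4%N + g 5%N).
  by apply/eqP; rewrite -addr_eq0; apply/eqP; apply: etrans sum0; ring.
by ring.
Qed.

Lemma A5_sub (x : 'cV[R]_6) : A_lattice x ->
  exists z, x = phi_basis *m int_mx R z.
Proof.
move=> [xint sum0].
have [g gE] := col_nat (map_mx Num.floor x).
have xE i : x i 0 = (g i)%:~R by rewrite -gE mxE floorK.
have [|f [fracE intE]] := @A5_coordinates _ g.
  rewrite -(sum_iota 6 g); apply: (@intr_inj R); rewrite rmorph_sum -[RHS]sum0.
  by apply: eq_bigr => i _; rewrite xE.
exists (\col_j f j); apply/colP => i.
rewrite (@phi_basis_int _ f) => [|j]; last by rewrite mxE.
by rewrite fracE intE // xE rmorphB rmorphM /=; field.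
Qed.

(** The multiples [0], [1], [2] of the last basis vector represent the cosets,
    which are told apart by [phi_frac] modulo [3]. *)
Lemma phi_coxeter : coxeter_A5_3 (lattice_of phi_basis).
Proof.
have int_diff (z z' : 'cV[int]_5) f f' : (forall j, z j 0 = f (j : nat)) ->
    (forall j, z' j 0 = f' (j : nat)) ->
  A_lattice (phi_basis *m int_mx R z - phi_basis *m int_mx R z') <->
  (3 %| phi_frac f - phi_frac f')%Z.
  move=> zE z'E.
  have entry i : (phi_basis *m int_mx R z - phi_basis *m int_mx R z') i 0 =
      (phi_frac f - phi_frac f')%:~R / 3 + (phi_int f i - phi_int f' i)%:~R.
    rewrite mxE [X in _ + X]mxE (phi_basis_int _ zE) (phi_basis_int _ z'E).
    by rewrite !rmorphB; field.
  have R3 : (3 : R) != 0 by rewrite pnatr_eq0.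
  split=> [[/(_ ord_max) + _]|/dvdzP[q qE]].
    rewrite entry /phi_int /= subrr addr0 => /intrP[q qE].
    apply/dvdzP; exists q; apply: (@intr_inj R); rewrite rmorphM /= -qE.
    by rewrite divfK.
  split=> [i|].
    by rewrite entry qE rmorphM /= mulfK // rpredD ?intr_int.
  by rewrite -mulmxBr phi_basis_sum.
split; first split.
- by move=> x /A5_sub[z ->]; exists z.
- exists (fun i => phi_basis *m int_mx R (\col_j (if j == 4%N :> nat then i%:Z else 0))); split.
    by move=> i; exists (\col_j (if j == 4%N :> nat then i%:Z else 0)).
  move=> _ [z _ <-]; have [f zE] := col_nat z.
  have rep (i : 'I_3) : A_lattice (phi_basis *m int_mx R z -
      phi_basis *m int_mx R (\col_j (if j == 4%N :> nat then i%:Z else 0)))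
      <-> (3 %| phi_frac f + i%:Z)%Z.
    rewrite (int_diff _ _ f (fun j => if j == 4%N then i%:Z else 0)) // => [|j]; last by rewrite mxE.
    by rewrite /phi_frac /= !add0r opprK.
  have lt3 : (absz (- phi_frac f %% 3)%Z < 3)%N by lia.
  exists (Ordinal lt3); split; first by apply/rep => /=; lia.
  by move=> i /rep i3; apply: val_inj => /=; have := ltn_ord i; lia.
move=> _ [z _ <-]; split.
  exists (limg (linfun (mulmx phi_basis : 'cV[R]_5 -> _))).
    apply: (@linear_hull_lattice _ _ _ _ _ 3); first by rewrite pnatr_eq0.
      by move=> x /A5_sub[u ->]; exists (int_mx R u).
    move=> u; have [f uE] := col_nat u; split=> [i|].
      rewrite mxE (phi_basis_int _ uE) mulrDr mulrC divfK ?pnatr_eq0 //.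
      by rewrite rpredD ?rpredM ?intr_int //; exact: (intr_int _ 3).
    by under eq_bigr do rewrite mxE; rewrite -mulr_sumr phi_basis_sum mulr0.
  have := memv_img (linfun (mulmx phi_basis : 'cV[R]_5 -> _)) (memvf (int_mx R z)); rewrite lfunE; exact.
move=> x [xint x0]; have [f zE] := col_nat z.
have -> : ((phi_basis *m int_mx R z)^T *m x) 0 0 = \sum_(i < 6) (phi_int f i)%:~R * x i 0.
  transitivity ((phi_frac f)%:~R / 3 * \sum_i x i 0 + \sum_(i < 6) (phi_int f i)%:~R * x i 0).
    rewrite mxE mulr_sumr -big_split; apply: eq_bigr => i _.
    by rewrite mxE (phi_basis_int _ zE) mulrDl.
  by rewrite x0 mulr0 add0r.
by apply: rpred_sum => i _; rewrite rpredM ?intr_int.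
Qed.

Lemma phi25_equivalent_TF : exists2 A : 'M[R]_5, is_phi25 A & equivalent (TF R 5) A.
Proof.
have c0 : 0 < 4 / 3 :> R by rewrite divr_gt0.
exists (phi_basis^T *m phi_basis).
  exists (lattice_of phi_basis); first exact: phi_coxeter.
  apply: gram_form_lattice_of; rewrite phi_gram.
  apply: posdefZ => //; exact: (TF_posdef R (isT : (4 <= 4)%N)).
exists (4 / 3), 1%:M; split; [exact: c0|exact: unitmx1|].
by rewrite phi_gram /int_mx map_mx1 trmx1 mul1mx mulmx1.
Qed.

End Coxeter.

(** * The dual of E_6 *)

Section DualE6.
Local Open Scope ring_scope.
Local Open Scope classical_set_scope.
Variable R : realType.

(** Projections of vectors of E_8 to the space where the last three coordinates
    agree: of [e_j + e_5] for [j < 5], and of a vector whose first five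
    coordinates are [-1/2]. *)
Definition E6_dual_entry (i j : nat) : R :=
  if j == 5%N then (if (i < 5)%N then - 2^-1 else - (7 / 6))
  else if (i < 5)%N then (i == j)%:R else 3^-1.

Definition E6_dual_basis : 'M[R]_(8, 6) := \matrix_(i, j) E6_dual_entry i j.

(** The dual basis; its columns are vectors of E_6. *)
Definition E6_entry (i j : nat) : R :=
  if j == 5%N then (if (i < 5)%N then 1 else - 1)
  else if (i < 5)%N then (i == j)%:R + 2^-1 else - 2^-1.

Definition E6_basis : 'M[R]_(8, 6) := \matrix_(i, j) E6_entry i j.

Lemma E6_dual_gram : E6_dual_basis^T *m E6_dual_basis = (4 / 3) *: TF R 6.
Proof.
apply/matrixP => i j; rewrite mxE.
under eq_bigr do rewrite !mxE.
rewrite (sum_iota 8 (fun l => E6_dual_entry l i * E6_dual_entry l j)) !mxE.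
case: i j => [[|[|[|[|[|[|i]]]]]] //= lti] [[|[|[|[|[|[|j]]]]]] //= ltj].
all: by rewrite /E6_dual_entry /=; field.
Qed.

Lemma E6_bases_dual : E6_basis^T *m E6_dual_basis = 1%:M.
Proof.
apply/matrixP => i j; rewrite mxE.
under eq_bigr do rewrite !mxE.
rewrite (sum_iota 8 (fun l => E6_entry l i * E6_dual_entry l j)) !mxE.
case: i j => [[|[|[|[|[|[|i]]]]]] //= lti] [[|[|[|[|[|[|j]]]]]] //= ltj].
all: by rewrite /E6_entry /E6_dual_entry /=; field.
Qed.

Lemma E6_basis_sub j : E6_lattice (col j E6_basis).
Proof.
have colE i : col j E6_basis i 0 = E6_entry i j by rewrite !mxE.
split; last by move=> i l; rewrite !colE /E6_entry !ltnNge => -> ->.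
split.
  have [jE|jN] := eqVneq (j : nat) 5%N.
    by left=> i; rewrite colE /E6_entry jE eqxx; case: ifP => _; rewrite ?rpredN ?rpred1.
  right=> i; rewrite colE /E6_entry (negPf jN); case: ifP => _.
    by rewrite addrK; case: eqP => _; rewrite ?rpred0 ?rpred1.
  by rewrite (_ : - 2^-1 - 2^-1 = -1) ?rpredN ?rpred1 //; field.
exists 1; under eq_bigr do rewrite colE.
rewrite (sum_iota 8 (fun l => E6_entry l j)).
by case: j {colE} => [[|[|[|[|[|[|j]]]]]] //= ltj]; rewrite /E6_entry /=; field.
Qed.

Lemma E6_sub (x : 'cV[R]_8) : E6_lattice x -> x = E6_dual_basis *m (E6_basis^T *m x).
Proof.
move=> [_ tail]; have [f xE] := col_nat x.
have f6 : f 6%N = f 5%N.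
  by have := tail (inord 6) (inord 5); rewrite !xE !inordK // => /(_ isT isT).
have f7 : f 7%N = f 5%N.
  by have := tail (inord 7) (inord 5); rewrite !xE !inordK // => /(_ isT isT).
pose g j := foldr (fun l a => E6_entry l j * f l + a) 0 (iota 0 8).
apply/colP => i; rewrite (@mulmx_iota _ _ _ _ _ E6_dual_entry g) => [|l j|j].
- by rewrite xE; case: i => [[|[|[|[|[|[|[|[|i]]]]]]]] //= lti];
    rewrite /g /= /E6_dual_entry /E6_entry /= ?f6 ?f7; field.
- by rewrite mxE.
by rewrite (@mulmx_iota _ _ _ _ _ (fun j l => E6_entry l j) f) // => l m; rewrite !mxE.
Qed.

Lemma E6_dual_basis_int (x : 'cV[R]_8) j :
  E6_lattice x -> (E6_dual_basis^T *m x) j 0 \is a Num.int.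
Proof.
move=> [[xint [s sE]] tail]; have [f xE] := col_nat x.
have f6 : f 6%N = f 5%N.
  by have := tail (inord 6) (inord 5); rewrite !xE !inordK // => /(_ isT isT).
have f7 : f 7%N = f 5%N.
  by have := tail (inord 7) (inord 5); rewrite !xE !inordK // => /(_ isT isT).
have sumf : f 0%N + f 1%N + f 2%N + f 3%N + f 4%N + 3 * f 5%N = (2 * s)%:~R.
  rewrite -sE; under eq_bigr do rewrite xE.
  by rewrite (sum_iota 8 f) /= f6 f7; ring.
have fint i l : (i < 8)%N -> (l < 8)%N -> f i + f l \is a Num.int.
  move=> lti ltl; rewrite -[i](@inordK 7) // -[l](@inordK 7) // -!xE.
  case: xint => xint; first by rewrite rpredD.
  rewrite (_ : _ + _ = (x (inord i) 0 - 2^-1) + (x (inord l) 0 - 2^-1) + 1); last by field.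
  by rewrite rpredD ?rpred1 // rpredD.
rewrite (@mulmx_iota _ _ _ _ _ (fun j l => E6_dual_entry l j) f) // => [|l m]; last by rewrite !mxE.
case: j => [[|[|[|[|[|[|j]]]]]] //= ltj]; rewrite /E6_dual_entry /= f6 f7.
1-5: by [rewrite [X in X \is a _](_ : _ = f 0%N + f 5%N) ?fint //; field |
         rewrite [X in X \is a _](_ : _ = f 1%N + f 5%N) ?fint //; field |
         rewrite [X in X \is a _](_ : _ = f 2%N + f 5%N) ?fint //; field |
         rewrite [X in X \is a _](_ : _ = f 3%N + f 5%N) ?fint //; field |
         rewrite [X in X \is a _](_ : _ = f 4%N + f 5%N) ?fint //; field].
rewrite [X in X \is a _](_ : _ = (- s)%:~R - (f 5%N + f 5%N)).
  by rewrite rpredB ?intr_int ?fint.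
rewrite rmorphN /=; move: sumf; rewrite rmorphM /= => sumf.
have -> : (s%:~R : R) = (f 0%N + f 1%N + f 2%N + f 3%N + f 4%N + 3 * f 5%N) / 2.
  by rewrite sumf; field.
by field.
Qed.

Lemma E6_dual_multiple (z : 'cV[int]_6) :
  E6_lattice (6 *: (E6_dual_basis *m int_mx R z)).
Proof.
have [f zE] := col_nat z; set y := _ *m _.
have yE i : y i 0 = foldr (fun j a => E6_dual_entry i j * (f j)%:~R + a) 0 (iota 0 6).
  by apply: mulmx_iota => [l j|j]; rewrite mxE // zE.
split; last first.
  by move=> i j i5 j5; rewrite [LHS]mxE [RHS]mxE !yE /E6_dual_entry !(ltnNge _ 5) i5 j5.
split.
  left=> i; rewrite mxE yE.
  rewrite (_ : 6 * _ = (if (i < 5)%N then 6 * f i - 3 * f 5%N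
    else 2 * (f 0%N + f 1%N + f 2%N + f 3%N + f 4%N) - 7 * f 5%N)%:~R) ?intr_int //.
  by case: i => [[|[|[|[|[|[|[|[|i]]]]]]]] //= lti];
    rewrite /E6_dual_entry /= !(rmorphB, rmorphM, rmorphD) /=; field.
exists (6 * (f 0%N + f 1%N + f 2%N + f 3%N + f 4%N) - 18 * f 5%N).
under eq_bigr do rewrite mxE yE.
rewrite (sum_iota 8 (fun i => 6 * foldr (fun j a => E6_dual_entry i j * (f j)%:~R + a) 0 (iota 0 6))).
rewrite /= /E6_dual_entry /= !(rmorphM, rmorphB, rmorphD) /=.
by field.
Qed.

Lemma E6_dual_equivalent_TF : exists2 A : 'M[R]_6, is_E6_dual A & equivalent (TF R 6) A.
Proof.
have c0 : 0 < 4 / 3 :> R by rewrite divr_gt0.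
exists (E6_dual_basis^T *m E6_dual_basis).
  rewrite /is_E6_dual (@dual_lattice_basis _ _ _ _ E6_dual_basis E6_basis).
  - apply: gram_form_lattice_of; rewrite E6_dual_gram.
    apply: posdefZ => //; exact: (TF_posdef R (isT : (4 <= 5)%N)).
  - apply: (@linear_hull_lattice _ _ _ _ _ 6); first by rewrite pnatr_eq0.
      by move=> x /E6_sub ->; eexists.
    exact: E6_dual_multiple.
  - exact: E6_bases_dual.
  - exact: E6_basis_sub.
  - by move=> x j; exact: E6_dual_basis_int.
exists (4 / 3), 1%:M; split; [exact: c0|exact: unitmx1|].
by rewrite E6_dual_gram /int_mx map_mx1 trmx1 mul1mx mulmx1.
Qed.

End DualE6.

Theorem theorem5p1 (R : realType) :
  (forall n : nat, (4 < n)%N ->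
     perfect (TF R n) /\
     exists2 C : set 'M[R]_n,
       domain_of_type_D C &
       common_wall (n * n.+1)./2 C (perfect_domain (TF R n)) (TW R n)) /\
  (exists2 A : 'M[R]_5, is_phi25 A & equivalent (TF R 5) A) /\
  (exists2 A : 'M[R]_6, is_E6_dual A & equivalent (TF R 6) A).
Proof.
split; last by split; [exact: phi25_equivalent_TF|exact: E6_dual_equivalent_TF].
case=> [//|k] k4; have [perfTF _ wallTW] := TW_common_wall R k4.
split=> //; exists (perfect_domain (half_D R k)) => //.
exact: half_D_domain.
Qed.
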